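(* Let $N\ge 1$ be an integer, $q>1$, $\delta\ge 1$, $\eta_-,\eta_+\ge 0$, $M\ge 0$, and let $p$ be the conjugate exponent of $q$ ($\frac1p+\frac1q=1$). Then there is a constant $\theta>p$, depending only on $q,\delta,N,\eta_-,\eta_+,M$, and, for every $\rho>0$, a constant $C=C(\rho)\ge 0$, depending only on $q,\delta,N,\eta_-,\eta_+,M$ and $\rho$, such that the following holds. Let $\mathcal{O}\subset\mathbb{R}^N_x\times\mathbb{R}_t$ be open, let $H:\mathcal{O}\times\mathbb{R}^N\to\mathbb{R}$ be a continuous function satisfying $$\frac1\delta|z|^q-\eta_-\le H(x,t,z)\le\delta|z|^q+\eta_+\qquad\forall (x,t,z)\in\mathcal{O}\times\mathbb{R}^N,$$ and let $u$ be a continuous viscosity solution of $$u_t+H(x,t,Du)=0\quad\text{in }\mathcal{O}$$ satisfying $|u|\le M$ in $\mathcal{O}$. Then, for every $\rho>0$, $$|u(x,t)-u(y,s)|\le C(\rho)\left[|x-y|^{\frac{\theta-p}{\theta-1}}+|t-s|^{\frac{\theta-p}{\theta}}\right]\qquad\forall (x,t),(y,s)\in\mathcal{O}_\rho .$$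
   Context: For $\rho>0$, $\mathcal{O}_\rho=\{(x,t)\in\mathcal{O}: d_{\mathcal{O}^c}(x,t)>\rho\}$, where $d_{\mathcal{O}^c}$ is the Euclidean distance function from the complement $\mathcal{O}^c$ of $\mathcal{O}$ in $\mathbb{R}^N\times\mathbb{R}$. $u_t=\partial u/\partial t$ and $Du$ is the gradient in $x$. $H$ is not assumed convex in $z$. *)

(* Defs.v *)
From HB Require Import structures.
From mathcomp Require Import all_boot all_order all_algebra.
From mathcomp Require Import all_classical all_reals all_analysis.

Set Implicit Arguments.
Unset Strict Implicit.
Unset Printing Implicit Defensive.

Import Order.TTheory GRing.Theory Num.Theory.
Import numFieldNormedType.Exports.

Local Open Scope classical_set_scope.
Local Open Scope ring_scope.

(* The library norm on ['rV[R]_N] and on products is the sup norm; it induces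
   the usual topology, but Euclidean lengths have to be defined separately. *)
Definition enorm (R : realType) (N : nat) (x : 'rV[R]_N) : R :=
  Num.sqrt (\sum_(i < N) x 0 i ^+ 2).

Definition st_edist (R : realType) (N : nat) (a b : 'rV[R]_N * R) : R :=
  Num.sqrt (enorm (a.1 - b.1) ^+ 2 + (a.2 - b.2) ^+ 2).

(* Extended-real valued, so that the distance to the empty set is [+oo]; in
   particular [inner_set setT rho = setT]. *)
Definition set_edist (R : realType) (N : nat) (A : set ('rV[R]_N * R))
    (a : 'rV[R]_N * R) : \bar R :=
  ereal_inf [set (st_edist a b)%:E | b in A].

Definition inner_set (R : realType) (N : nat) (O : set ('rV[R]_N * R))
    (rho : R) : set ('rV[R]_N * R) :=
  [set a | O a /\ (rho%:E < set_edist (~` O) a)%E].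

Definition dt (R : realType) (N : nat) (f : 'rV[R]_N * R -> R)
    (a : 'rV[R]_N * R) : R :=
  'D_(0, 1) f a.

Definition grad_x (R : realType) (N : nat) (f : 'rV[R]_N * R -> R)
    (a : 'rV[R]_N * R) : 'rV[R]_N :=
  \row_(i < N) 'D_(delta_mx 0 i, 0) f a.

(* Functions on [O] are total functions whose values outside [O] are
   irrelevant. *)
Definition C1_on (R : realType) (N : nat) (O : set ('rV[R]_N * R))
    (f : 'rV[R]_N * R -> R) : Prop :=
  [/\ forall a, O a -> differentiable f a,
      {within O, continuous (dt f)} &
      {within O, continuous (grad_x f)}].

Definition local_max (R : realType) (N : nat) (f : 'rV[R]_N * R -> R)
    (a : 'rV[R]_N * R) : Prop :=
  \forall b \near a, f b <= f a.

Definition local_min (R : realType) (N : nat) (f : 'rV[R]_N * R -> R)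
    (a : 'rV[R]_N * R) : Prop :=
  \forall b \near a, f a <= f b.

(* Below, [O] is meant to be open, so that neighbourhoods of a point of [O] in
   the whole space and in [O] agree, and [H] takes [((x, t), z)]. *)
Definition viscosity_subsolution (R : realType) (N : nat)
    (O : set ('rV[R]_N * R)) (H : ('rV[R]_N * R) * 'rV[R]_N -> R)
    (u : 'rV[R]_N * R -> R) : Prop :=
  forall (phi : 'rV[R]_N * R -> R) (a : 'rV[R]_N * R),
    C1_on O phi -> O a -> local_max (fun b => u b - phi b) a ->
    dt phi a + H (a, grad_x phi a) <= 0.

Definition viscosity_supersolution (R : realType) (N : nat)
    (O : set ('rV[R]_N * R)) (H : ('rV[R]_N * R) * 'rV[R]_N -> R)
    (u : 'rV[R]_N * R -> R) : Prop :=
  forall (phi : 'rV[R]_N * R -> R) (a : 'rV[R]_N * R),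
    C1_on O phi -> O a -> local_min (fun b => u b - phi b) a ->
    0 <= dt phi a + H (a, grad_x phi a).

Definition continuous_viscosity_solution (R : realType) (N : nat)
    (O : set ('rV[R]_N * R)) (H : ('rV[R]_N * R) * 'rV[R]_N -> R)
    (u : 'rV[R]_N * R -> R) : Prop :=
  [/\ {within O, continuous u}, viscosity_subsolution O H u &
      viscosity_supersolution O H u].

(* Main.v *)
From HB Require Import structures.
Require Import Defs.
From mathcomp Require Import all_boot all_order all_algebra.
From mathcomp Require Import all_classical all_reals all_analysis.
From mathcomp Require Import ring lra.

Import Order.TTheory GRing.Theory Num.Theory.
Import numFieldNormedType.Exports.

Local Open Scope classical_set_scope.
Local Open Scope ring_scope.

(** Only two consequences of the equation matter: [u] is a subsolution of
    [u_t + |Du|^q / delta <= e] and a supersolution of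
    [u_t + delta |Du|^q >= - e], with [e = eta_m + eta_p]. The proof shows that
    these two inequalities force the oscillation of [u] to decay geometrically
    on cylinders shrunk according to the scaling of the equation.

    At unit scale, with values in [[0, 1]] and small [e]
    ([oscillation_step]), look at the time [-1/16]. If [u < 1/2] at one
    point [y] near the origin, the growth of the Hamiltonian at infinity lets
    this low value spread: comparison with a cone of vertex [y], whose slope is
    initially huge and relaxes with time, gives [u <= 3/4] near the origin at
    times close to [0] ([falls_near_low_point]). Otherwise [u >= 1/2] on a
    whole ball at time [-1/16], and comparison with a flat paraboloid which
    sinks slowly gives [u >= mu / 2] near the origin at times close to [0]
    ([grows_from_lower_bound]). In both cases the oscillation drops by a factor
    [1 - kap] on a smaller cylinder.

    A solution of height [w] on a cylinder of radius [r] and duration [T] becomes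
    a solution at unit scale when [(w / r)^q = w / T], with [e] replaced by
    [e T / w] ([zoom_sub_on], [zoom_super_on]). Iterating
    ([oscillation_decay]), the height is multiplied by [mu = 1 - kap], the
    radius by [l] and the duration by [b = mu (l / mu)^q]; the error
    [e T / w] decreases since [b <= mu]. If [mu = l^al], then [b = l^be] with
    [be = q - (q - 1) al], so that [u] is Hoelder continuous with exponent [al] in
    space and [al / be] in time. For [theta = (p - al) / (1 - al)] these are
    exactly [(theta - p) / (theta - 1)] and [(theta - p) / theta], and
    [theta > p] because [p > 1]. *)

(** * Squared Euclidean length and radial test functions *)

(** Working with the square makes the length smooth at the origin, and the
    parallelogram bound [nsqD_le] can stand in for the triangle inequality. *)
Definition nsq {R : realType} {N : nat} (x : 'rV[R]_N) : R :=
  \sum_(i < N) x 0 i ^+ 2.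

Section nsq.
Context {R : realType} {N : nat}.
Implicit Types x y : 'rV[R]_N.

Lemma nsq_ge0 x : 0 <= nsq x.
Proof. by apply: sumr_ge0 => i _; exact: sqr_ge0. Qed.

Lemma enorm_ge0 x : 0 <= enorm x.
Proof. exact: sqrtr_ge0. Qed.

Lemma enorm_sqr x : enorm x ^+ 2 = nsq x.
Proof. by rewrite sqr_sqrtr// nsq_ge0. Qed.

Lemma nsqZ (c : R) x : nsq (c *: x) = c ^+ 2 * nsq x.
Proof. by rewrite /nsq mulr_sumr; apply: eq_bigr => i _; rewrite mxE exprMn. Qed.

Lemma enormZ (c : R) x : enorm (c *: x) = `|c| * enorm x.
Proof. by rewrite /enorm -/(nsq _) nsqZ sqrtrM ?sqr_ge0// sqrtr_sqr. Qed.

Lemma nsqD_le x y : nsq (x + y) <= 2 * (nsq x + nsq y).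
Proof.
rewrite /nsq -big_split mulr_sumr; apply: ler_sum => i _ /=.
by rewrite mxE; have := sqr_ge0 (x 0 i - y 0 i); nra.
Qed.

Lemma nsqN x : nsq (- x) = nsq x.
Proof. by rewrite -scaleN1r nsqZ sqrrN expr1n mul1r. Qed.

Lemma enorm_le x (c : R) : 0 <= c -> (enorm x <= c) = (nsq x <= c ^+ 2).
Proof. by move=> c0; rewrite -enorm_sqr ler_pXn2r// nnegrE enorm_ge0. Qed.

Lemma nsq_coord x i : x 0 i ^+ 2 <= nsq x.
Proof.
rewrite /nsq (bigD1 i)//= lerDl; apply: sumr_ge0 => j _; exact: sqr_ge0.
Qed.

Lemma coord_is_diff (i : 'I_N) (a : 'rV[R]_N * R) :
  is_diff a (fun b : 'rV[R]_N * R => b.1 0 i) (fun v => v.1 0 i).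
Proof.
pose l (b : 'rV[R]_N * R) := b.1 0 i.
have lin_l : linear l by move=> c u v; rewrite /l /= !mxE.
pose lM := GRing.isLinear.Build _ _ _ _ _ lin_l.
pose lL : {linear _ -> _} := HB.pack l lM.
have lc : continuous lL.
  move=> b; apply: (@continuous_comp _ _ _ fst (fun m : 'rV[R]_N => m 0 i)).
    exact: cvg_fst.
  exact: coord_continuous.
have dl : differentiable lL a by exact: linear_differentiable.
by apply: DiffDef => //; rewrite -[LHS]/('d lL a : _ -> _) diff_lin.
Qed.

Lemma snd_is_diff (a : 'rV[R]_N * R) :
  is_diff a (fun b : 'rV[R]_N * R => b.2) (fun v => v.2).
Proof.
have sc : continuous (snd : 'rV[R]_N * R -> R) by move=> b; exact: cvg_snd.
have ds : differentiable (snd : 'rV[R]_N * R -> R) a by exact: linear_differentiable.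
by apply: DiffDef => //; rewrite diff_lin.
Qed.

Lemma nsq_is_diff (y : 'rV[R]_N) (a : 'rV[R]_N * R) :
  is_diff a (fun b : 'rV[R]_N * R => nsq (b.1 - y))
    (fun v => 2 * \sum_(i < N) (a.1 - y) 0 i * v.1 0 i).
Proof.
have -> : (fun b : 'rV[R]_N * R => nsq (b.1 - y)) =
    \sum_(i < N) ((fun b : 'rV[R]_N * R => b.1 0 i) - cst (y 0 i)) ^+ 2.
  by apply/funext => b; rewrite fct_sumE; apply: eq_bigr => i _; rewrite !mxE.
have di i : is_diff a (((fun b : 'rV[R]_N * R => b.1 0 i) - cst (y 0 i)) ^+ 2)
    (fun v => 2 * ((a.1 - y) 0 i * v.1 0 i)).
  have := coord_is_diff i a => ci.
  apply: is_diff_eq; apply/funext => v /=.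
  rewrite !fctE /= !mxE; rewrite subr0 expr1 /GRing.scale/=; lra.
have ds : differentiable (\sum_(i < N) ((fun b : 'rV[R]_N * R => b.1 0 i) - cst (y 0 i)) ^+ 2) a.
  by apply: differentiable_sum.
apply: DiffDef => //.
apply/funext => v; rewrite -deriveE// derive_sum; last first.
  by move=> i; apply: diff_derivable.
rewrite mulr_sumr; apply: eq_bigr => i _.
by rewrite deriveE// diff_val.
Qed.

Lemma derive_is_diff (f : R -> R) (x df : R) :
  is_derive x 1 f df -> is_diff x f (fun h => h * df).
Proof.
move=> [fx dfx]; have dx : differentiable f x by apply/derivable1_diffP.
by apply: DiffDef => //; rewrite diff1E// derive1E dfx.
Qed.

Lemma radial_is_diff (y : 'rV[R]_N) (f g k : R -> R) (a : 'rV[R]_N * R) (df dg dk : R) :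
  is_derive (nsq (a.1 - y)) 1 f df -> is_derive a.2 1 g dg ->
  is_derive a.2 1 k dk ->
  is_diff a (fun b : 'rV[R]_N * R => f (nsq (b.1 - y)) * g b.2 + k b.2)
    (fun v => f (nsq (a.1 - y)) * (dg * v.2) +
        g a.2 * (df * (2 * \sum_(i < N) (a.1 - y) 0 i * v.1 0 i)) + dk * v.2).
Proof.
move=> /derive_is_diff fd /derive_is_diff gd /derive_is_diff kd.
have ny := nsq_is_diff y a; have ns := snd_is_diff a.
have fn := is_diff_comp ny fd.
have gn := is_diff_comp ns gd.
have kn := is_diff_comp ns kd.
rewrite -[F in is_diff _ F]/((f \o (fun b : 'rV[R]_N * R => nsq (b.1 - y))) *
   (g \o (fun b : 'rV[R]_N * R => b.2)) + (k \o (fun b : 'rV[R]_N * R => b.2))).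
apply: (is_diff_eq (is_diffD (is_diffM fn gn) kn)); apply/funext => v.
rewrite !fctE /= /GRing.scale /=; ring.
Qed.

Lemma nsq_continuous (y : 'rV[R]_N) : continuous (fun a : 'rV[R]_N * R => nsq (a.1 - y)).
Proof. by move=> a; apply: differentiable_continuous; case: (nsq_is_diff y a). Qed.

(** All barriers below have this shape: a radial profile [f] in space, modulated in
    time by [g], plus a drift [k]. The profile is a function of the squared
    length, so its derivative is required at nonnegative numbers only. *)
Lemma radial_C1 (y : 'rV[R]_N) (f g k f' g' k' : R -> R) :
  (forall w : R, 0 <= w -> is_derive w 1 f (f' w)) ->
  (forall t : R, is_derive t 1 g (g' t)) -> (forall t : R, is_derive t 1 k (k' t)) ->
  (forall w : R, 0 <= w -> {for w, continuous f'}) ->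
  continuous g' -> continuous k' ->
  let Phi := fun b : 'rV[R]_N * R => f (nsq (b.1 - y)) * g b.2 + k b.2 in
  [/\ C1_on setT Phi,
   forall a, dt Phi a = f (nsq (a.1 - y)) * g' a.2 + k' a.2 &
   forall a, grad_x Phi a = (2 * f' (nsq (a.1 - y)) * g a.2) *: (a.1 - y)].
Proof.
move=> fd gd kd fc gc kc Phi.
have Pd a := radial_is_diff y f g k a _ _ _ (fd _ (nsq_ge0 (a.1 - y))) (gd a.2) (kd a.2).
have dtE a : dt Phi a = f (nsq (a.1 - y)) * g' a.2 + k' a.2.
  rewrite /dt deriveE; last by case: (Pd a).
  have [_ ->] := Pd a; rewrite /=.
  rewrite big1 ?mulr0 ?addr0 ?mulr1//.
  by move=> i _; rewrite !mxE mulr0.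
have gE a : grad_x Phi a = (2 * f' (nsq (a.1 - y)) * g a.2) *: (a.1 - y).
  apply/rowP => i; rewrite mxE deriveE; last by case: (Pd a).
  have [_ ->] := Pd a; rewrite /= !mulr0 add0r addr0 (bigD1 i)//= big1 => [|j ji].
    by rewrite !mxE !eqxx /=; ring.
  by rewrite !mxE (negbTE ji) andbF mulr0.
have cn : continuous (fun a : 'rV[R]_N * R => nsq (a.1 - y)).
  exact: nsq_continuous.
have c2 (h : R -> R) : continuous h -> continuous (fun a : 'rV[R]_N * R => h a.2).
  by move=> hc a; apply: continuous_comp; [exact: cvg_snd|exact: hc].
have cd (h h' : R -> R) : (forall t : R, is_derive t 1 h (h' t)) -> continuous h.
  move=> hd t; apply: differentiable_continuous; apply/derivable1_diffP.
  by case: (hd t).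
have fcont w : 0 <= w -> {for w, continuous f}.
  move=> w0; apply: differentiable_continuous; apply/derivable1_diffP.
  by case: (fd w w0).
have c1 (h : R -> R) : (forall w : R, 0 <= w -> {for w, continuous h}) ->
    continuous (fun a : 'rV[R]_N * R => h (nsq (a.1 - y))).
  by move=> hc a; apply: continuous_comp; [exact: cn|exact/hc/nsq_ge0].
split => //; split.
- by move=> a _; case: (Pd a).
- rewrite (_ : dt Phi = (fun a => f (nsq (a.1 - y)) * g' a.2 + k' a.2)); last exact/funext.
  apply: continuous_subspaceT => a.
  by apply: cvgD; [apply: cvgM; [exact: c1|exact: c2]|exact: c2].
- rewrite (_ : grad_x Phi =
     (fun a => (2 * f' (nsq (a.1 - y)) * g a.2) *: (a.1 - y))); last exact/funext.
  apply: continuous_subspaceT => a; apply: cvgZ.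
    apply: cvgM; last by apply: c2; exact: cd gd.
    by apply: cvgMr; exact: c1.
  by apply: cvgB; [exact: cvg_fst|exact: cvg_cst].
Qed.

End nsq.

(** * Comparison on cylinders *)

Section comparison.
Context {R : realType} {N : nat}.

Definition cyl (y : 'rV[R]_N) (r2 s T : R) : set ('rV[R]_N * R) :=
  [set a | nsq (a.1 - y) <= r2 /\ s <= a.2 <= T].

Lemma cyl_compact y r2 s T : compact (cyl y r2 s T).
Proof.
have cK : compact ([set v : 'rV[R]_N |
    forall i, `[y 0 i - (1 + r2), y 0 i + (1 + r2)]%classic (v ord0 i)] `*` `[s, T]%classic).
  apply: compact_setX; last exact: segment_compact.
  apply: (@rV_compact R N (fun i => `[y 0 i - (1 + r2), y 0 i + (1 + r2)]%classic)) => i.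
  exact: segment_compact.
apply: subclosed_compact cK _.
  have -> : cyl y r2 s T = (fun a : 'rV[R]_N * R => nsq (a.1 - y)) @^-1` [set x | x <= r2] `&`
     ((fun a : 'rV[R]_N * R => a.2) @^-1` [set x | s <= x] `&`
     (fun a : 'rV[R]_N * R => a.2) @^-1` [set x | x <= T]).
    apply/seteqP; split => a /=; rewrite /cyl /=.
      by move=> [-> /andP[-> ->]].
    by move=> [-> [-> ->]].
  apply: closedI; [|apply: closedI]; apply: preimage_closed.
  - by move=> a _; exact: nsq_continuous.
  - exact: closed_le.
  - by move=> a _; exact: cvg_snd.
  - exact: closed_ge.
  - by move=> a _; exact: cvg_snd.
  - exact: closed_le.
move=> a [ar at_]; split => /=; last by rewrite in_itv.
move=> i; rewrite in_itv /=.
have := le_trans (nsq_coord (a.1 - y) i) ar; rewrite !mxE -/(@ord0 0).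
move: (a.1 ord0 i) (y ord0 i) => v w h.
have h1 := sqr_ge0 (v - w - 1); have h2 := sqr_ge0 (v - w + 1).
by apply/andP; split; nra.
Qed.

(** The final time belongs to the boundary, because solutions are tested at points
    that are maximal in a full neighbourhood, later times included. Barriers
    therefore have to win at the final time as well, which is the role of the
    drift in their definitions. *)
Lemma parabolic_max_principle (y : 'rV[R]_N) (r2 s T : R) (f : 'rV[R]_N * R -> R) :
  (forall a, cyl y r2 s T a -> {for a, continuous f}) ->
  (forall a, cyl y r2 s T a ->
     nsq (a.1 - y) = r2 \/ a.2 = s \/ a.2 = T -> f a <= 0) ->
  (forall a, nsq (a.1 - y) < r2 -> s < a.2 < T -> ~ local_max f a) ->
  forall a, cyl y r2 s T a -> f a <= 0.
Proof.
move=> fc fb fi a Da.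
have [||c] := @compact_EVT_max _ R f _ _ (cyl_compact y r2 s T).
- by exists a.
- apply: continuous_in_subspaceT => b; rewrite inE; exact: fc.
rewrite inE => Dc cmax; apply: (@le_trans _ _ (f c)); first by apply: cmax; rewrite inE.
have [cr /andP[cs cT]] := Dc.
have [e|cr'] := eqVneq (nsq (c.1 - y)) r2; first by apply: fb => //; left.
have [e|cs'] := eqVneq c.2 s; first by apply: fb => //; right; left.
have [e|cT'] := eqVneq c.2 T; first by apply: fb => //; right; right.
have {}cr : nsq (c.1 - y) < r2 by rewrite lt_neqAle cr' cr.
have {}cs : s < c.2 by rewrite lt_neqAle eq_sym cs' cs.
have {}cT : c.2 < T by rewrite lt_neqAle cT' cT.
exfalso; apply: (fi c cr); first by rewrite cs cT.
rewrite /local_max.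
have n1 : \forall b \near c, nsq (b.1 - y) < r2.
  exact: (cvgr_lt (nsq (c.1 - y)) (nsq_continuous y c)).
have n2 : \forall b \near c, b.2 < T by exact: (cvgr_lt c.2 (@cvg_snd _ _ _ _ _)).
have n3 : \forall b \near c, s < b.2 by exact: (cvgr_gt c.2 (@cvg_snd _ _ _ _ _)).
near=> b; apply: cmax; rewrite inE; split; first by apply: ltW; near: b.
by apply/andP; split; apply: ltW; near: b.
Unshelve. all: end_near. Qed.

(** The inequality [u_t + c |Du|^q <= e] in the viscosity sense. Test functions are
    [C^1] on the whole space, so that restricting to a smaller set and changing
    the scale are immediate. *)
Definition sub_on (Q : set ('rV[R]_N * R)) (c q e : R) (u : 'rV[R]_N * R -> R) :=
  forall phi a, C1_on setT phi -> Q a -> local_max (fun b => u b - phi b) a ->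
    dt phi a + c * enorm (grad_x phi a) `^ q <= e.

Definition super_on (Q : set ('rV[R]_N * R)) (c q e : R) (u : 'rV[R]_N * R -> R) :=
  forall phi a, C1_on setT phi -> Q a -> local_min (fun b => u b - phi b) a ->
    - e <= dt phi a + c * enorm (grad_x phi a) `^ q.

Lemma C1_continuous (phi : 'rV[R]_N * R -> R) a : C1_on setT phi -> {for a, continuous phi}.
Proof. by move=> [d _ _]; apply: differentiable_continuous; exact: d. Qed.

Lemma sub_comparison y r2 s T c q e (u phi : 'rV[R]_N * R -> R) :
  C1_on setT phi ->
  (forall a, cyl y r2 s T a -> {for a, continuous u}) ->
  sub_on (cyl y r2 s T) c q e u ->
  (forall a, nsq (a.1 - y) < r2 -> s < a.2 < T ->
     e < dt phi a + c * enorm (grad_x phi a) `^ q) ->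
  (forall a, cyl y r2 s T a ->
     nsq (a.1 - y) = r2 \/ a.2 = s \/ a.2 = T -> u a <= phi a) ->
  forall a, cyl y r2 s T a -> u a <= phi a.
Proof.
move=> C1 uc us strict bd a Da; rewrite -subr_le0.
apply: (@parabolic_max_principle y r2 s T (fun a => u a - phi a)) a Da.
- by move=> a Da; apply: cvgB; [exact: uc|exact: C1_continuous].
- by move=> a Da h; rewrite subr_le0; exact: bd.
- move=> a ar /andP[as_ aT] /us => /(_ C1); rewrite leNgt strict ?as_//.
  by move=> h; have := h (conj (ltW ar) _); rewrite (ltW as_) (ltW aT) => /(_ isT).
Qed.

Lemma super_comparison y r2 s T c q e (u phi : 'rV[R]_N * R -> R) :
  C1_on setT phi ->
  (forall a, cyl y r2 s T a -> {for a, continuous u}) ->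
  super_on (cyl y r2 s T) c q e u ->
  (forall a, nsq (a.1 - y) < r2 -> s < a.2 < T ->
     dt phi a + c * enorm (grad_x phi a) `^ q < - e) ->
  (forall a, cyl y r2 s T a ->
     nsq (a.1 - y) = r2 \/ a.2 = s \/ a.2 = T -> phi a <= u a) ->
  forall a, cyl y r2 s T a -> phi a <= u a.
Proof.
move=> C1 uc us strict bd a Da; rewrite -subr_le0.
apply: (@parabolic_max_principle y r2 s T (fun a => phi a - u a)) a Da.
- by move=> a Da; apply: cvgB; [exact: C1_continuous|exact: uc].
- by move=> a Da h; rewrite subr_le0; exact: bd.
- move=> a ar /andP[as_ aT] lm.
  have : local_min (fun b => u b - phi b) a.
    by apply: filterS lm => b; rewrite -[phi b - _]opprB -[phi a - _]opprB lerN2.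
  move/us => /(_ C1); rewrite leNgt strict ?as_//.
  by move=> h; have := h (conj (ltW ar) _); rewrite (ltW as_) (ltW aT) => /(_ isT).
Qed.
End comparison.

(** * Persistence of a lower bound *)

Section barriers.
Context {R : realType} {N : nat}.

(** The barrier is [mu (1 - |x|^2 / c^2) - 2 mu (t + 1/16)]. Its slope is at most
    [2 mu / c], so the smallness assumption on [mu] makes the Hamiltonian
    negligible with respect to the speed [2 mu]. That speed is also what brings
    the barrier below [0] at the final time [1/2]. *)
Lemma grows_from_lower_bound (q delta c mu e : R) (v : 'rV[R]_N * R -> R) :
  0 <= q -> 0 <= delta -> 0 < c -> 0 < mu <= 1/2 -> e <= mu ->
  delta * (2 * mu / c) `^ q <= mu / 2 ->
  (forall a, cyl 0 (c ^+ 2) (-1/16) (1/2) a -> {for a, continuous v}) ->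
  super_on (cyl 0 (c ^+ 2) (-1/16) (1/2)) delta q e v ->
  (forall a, cyl 0 (c ^+ 2) (-1/16) (1/2) a -> 0 <= v a) ->
  (forall x, nsq x <= c ^+ 2 -> 1/2 <= v (x, -1/16)) ->
  forall a, nsq a.1 <= (c / 2) ^+ 2 -> -1/32 <= a.2 <= 1/32 -> mu / 2 <= v a.
Proof.
move=> q0 delta0 c0 /andP[mu0 mu1] emu small vc vs v0 vi.
have c20 : 0 < c ^+ 2 by rewrite exprn_gt0.
pose f (w : R) : R := - (mu / c ^+ 2) * w.
pose g : R -> R := cst 1.
pose k (t : R) : R := mu - 2 * mu * (t + 1/16).
pose f' : R -> R := cst (- (mu / c ^+ 2)).
pose g' : R -> R := cst 0.
pose k' : R -> R := cst (- (2 * mu)).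
have fd (w : R) : 0 <= w -> is_derive w 1 f (f' w).
  move=> _; rewrite /f /f'.
  by apply: is_derive_eq; rewrite /GRing.scale/=; ring.
have gd (t : R) : is_derive t 1 g (g' t) by exact: is_derive_cst.
have kd (t : R) : is_derive t 1 k (k' t).
  rewrite /k /k'.
  by apply: is_derive_eq; rewrite /GRing.scale/=; ring.
have f'c (w : R) : 0 <= w -> {for w, continuous f'} by move=> _; exact: cst_continuous.
have [C1 dtE gE] := @radial_C1 R N 0 f g k f' g' k' fd gd kd f'c
  (@cst_continuous _ _ _) (@cst_continuous _ _ _).
set phi := fun b => _ in C1 dtE gE.
have phiE a : phi a = - (mu / c ^+ 2) * nsq (a.1 - 0) + (mu - 2 * mu * (a.2 + 1/16)).
  by rewrite /phi /f /g /k /= mulr1.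
have cmp : forall a, cyl 0 (c ^+ 2) (-1/16) (1/2) a -> phi a <= v a.
  apply: super_comparison C1 vc vs _ _.
    move=> a ar at_; rewrite dtE gE /f' /g' /k' /g /= mulr0 add0r.
    rewrite enormZ.
    have n1 : `|2 * - (mu / c ^+ 2) * 1| = 2 * (mu / c ^+ 2).
      by rewrite mulr1 mulrN normrN ger0_norm// mulr_ge0// divr_ge0// ltW.
    rewrite n1.
    have n2 : 2 * (mu / c ^+ 2) * enorm (a.1 - 0) <= 2 * mu / c.
      have e1 : enorm (a.1 - 0) <= c by rewrite enorm_le ?(ltW c0)// (ltW ar).
      have -> : 2 * mu / c = 2 * (mu / c ^+ 2) * c by field; rewrite gt_eqF.
      by rewrite ler_wpM2l// mulr_ge0// divr_ge0// ltW.
    have n3 : (2 * (mu / c ^+ 2) * enorm (a.1 - 0)) `^ q <= (2 * mu / c) `^ q.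
      apply: ge0_ler_powR => //; rewrite nnegrE.
        by rewrite mulr_ge0 ?enorm_ge0// mulr_ge0// divr_ge0// ltW.
      by rewrite divr_ge0 ?(ltW c0)// mulr_ge0// ltW.
    have := le_trans (ler_wpM2l delta0 n3) small.
    lra.
  move=> a Da; rewrite phiE => bd.
  have [ar /andP[as_ aT]] := Da.
  have q1 : 0 <= mu / c ^+ 2 * nsq (a.1 - 0).
    by rewrite mulr_ge0 ?nsq_ge0// divr_ge0// ltW.
  have q2 : 0 <= mu * (a.2 + 1/16) by rewrite mulr_ge0 ?(ltW mu0)//; lra.
  case: bd => [E|[E|E]].
  - have := v0 _ Da; rewrite E mulNr divfK ?gt_eqF//; lra.
  - have := vi a.1; rewrite -E -surjective_pairing -[in nsq _](subr0 a.1) => /(_ ar).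
    lra.
  - have := v0 _ Da; rewrite E; lra.
move=> a ar /andP[as_ aT]; apply: le_trans (cmp a _); last first.
  split; last by apply/andP; split; lra.
  rewrite subr0; apply: (le_trans ar); rewrite ler_pXn2r ?nnegrE//; lra.
rewrite phiE subr0 mulNr.
have : mu / c ^+ 2 * nsq a.1 <= mu / 4.
  have -> : mu / 4 = mu / c ^+ 2 * (c / 2) ^+ 2 by field; rewrite gt_eqF.
  by rewrite ler_wpM2l// divr_ge0// ltW.
have : mu * (a.2 + 1/16) <= mu * (3/32) by rewrite ler_wpM2l ?(ltW mu0)//; lra.
lra.
Qed.

End barriers.

(** * Derivatives and inequalities for the spreading cone *)

Section calculus.
Context {R : realType}.

Lemma is_derive_sqrt_shift (s B w : R) : 0 < s -> 0 <= w ->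
  is_derive w 1 (fun w => 2 * B * Num.sqrt (s + w)) (B / Num.sqrt (s + w)).
Proof.
move=> s0 w0; have sw : 0 < s + w by rewrite ltr_wpDr.
have dl : is_derive w 1 (fun w : R => s + w) 1.
  by apply: is_derive_eq; rewrite add0r mulr1.
have ds := @is_derive1_comp R Num.sqrt (fun w : R => s + w) w _ _ (is_derive1_sqrt sw) dl.
have := is_deriveZ (2 * B) ds => /is_derive_eq; apply.
rewrite /GRing.scale/= mulr1; field.
by rewrite gt_eqF// sqrtr_gt0.
Qed.

Lemma is_derive_inv_sqr_shiftX (s h : R) (n : nat) (t : R) : 0 < s ->
  is_derive t 1 (fun t => (s + (t + h) ^+ 2)^-1 ^+ n.+1)
    (- n.+1%:R * (s + (t + h) ^+ 2)^-1 ^+ n.+2 * (2 * (t + h))).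
Proof.
move=> s0; have st : 0 < s + (t + h) ^+ 2 by rewrite ltr_pwDl// sqr_ge0.
have dl : is_derive t 1 (fun t : R => s + (t + h) ^+ 2) (2 * (t + h)).
  by apply: is_derive_eq; rewrite /GRing.scale/=; ring.
have dv := @is_deriveV R (fun t : R => s + (t + h) ^+ 2) t _ 1 (negbT (gt_eqF st)) dl.
have := @is_deriveX _ _ _ n.+1 _ _ _ dv; rewrite exprfctE => /is_derive_eq; apply.
rewrite /GRing.scale/= -exprVn !exprS expr0; ring.
Qed.

Lemma powR_mul_powRB1 (x s : R) : 0 < x -> x `^ s = x * x `^ (s - 1).
Proof.
move=> x0; rewrite -[X in _ = X * _](powRr1 (ltW x0)) -powRD.
  by congr (_ `^ _); ring.
by rewrite (gt_eqF x0) implybT.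
Qed.

(** Superlinearity of the Hamiltonian at the slope [B / tau^n] of the cone: the
    exponent [n] is large enough for [tau^(- n (q - 1))] to produce the factor
    [1 / tau] that comes from the time derivative. *)
Lemma superlinear_absorbs (q delta B tau : R) (n : nat) :
  1 < q -> 0 < delta -> 1 <= n%:R * (q - 1) -> 1 <= B ->
  4 * n%:R * delta <= B `^ (q - 1) -> 0 < tau <= 1 ->
  4 * n%:R * B * tau^-1 ^+ n.+1 <= delta^-1 * (B * tau^-1 ^+ n) `^ q.
Proof.
move=> q1 delta0 nq B1 Bq /andP[tau0 tau1].
have B0 : 0 < B by apply: lt_le_trans B1.
have t1 : 1 <= tau^-1 by rewrite invf_ge1.
have t0 : 0 < tau^-1 by rewrite invr_gt0.
have L0 : 0 < B * tau^-1 ^+ n by rewrite mulr_gt0// exprn_gt0.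
rewrite (powR_mul_powRB1 _ _ L0) powRM ?(ltW B0)// ?exprn_ge0 ?(ltW t0)//.
have h1 : tau^-1 <= (tau^-1 ^+ n) `^ (q - 1).
  rewrite -powR_mulrn ?(ltW t0)// -powRrM.
  by rewrite -[X in X <= _](powRr1 (ltW t0)); apply: ler_powR.
have h2 : 4 * n%:R * delta * tau^-1 <= B `^ (q - 1) * (tau^-1 ^+ n) `^ (q - 1).
  by apply: ler_pM => //; rewrite ?(ltW t0)// mulr_ge0 ?(ltW delta0)// mulr_ge0.
have h3 := ler_wpM2l (ltW L0) h2.
rewrite -(ler_pM2l delta0) mulVKf ?gt_eqF//; apply: le_trans h3.
by rewrite le_eqVlt; apply/orP; left; apply/eqP; rewrite [in LHS]exprS; ring.
Qed.

Lemma ler_of_sqr (x z : R) : 0 <= z -> x ^+ 2 <= z ^+ 2 -> x <= z.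
Proof.
move=> z0 h; rewrite leNgt; apply/negP => zx; move: h.
by rewrite leNgt ltr_pXn2r ?zx// nnegrE// (le_trans z0 (ltW zx)).
Qed.

(** Positivity of [u_t + |Du|^q / delta - e] for the cone, in terms of
    [S = sqrt (s + d^2)], where [d] is the distance to the axis. Away from the
    smoothed tip the slope is at least [B / tau^(n+1)], and the Hamiltonian
    absorbs the time derivative by [superlinear_absorbs]. At the tip, where
    [d^2 < s], the time derivative itself is small by the choice of [s], and the
    unit drift wins. *)
Lemma cone_strict (q delta B e tau sg S d s t2 : R) (n : nat) :
  1 < q -> 0 < delta -> 1 <= n.+1%:R * (q - 1) -> 1 <= B ->
  4 * n.+1%:R * delta <= B `^ (q - 1) -> e <= 1/2 ->
  0 < sg -> sg <= tau <= 1 -> 0 < S <= 1 -> S ^+ 2 = s + d ^+ 2 -> 0 <= d ->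
  s <= (sg ^+ n.+2 / (16 * B * n.+1%:R)) ^+ 2 / 2 -> 0 <= t2 <= 2 ->
  e < 2 * B * S * (- n.+1%:R * tau^-1 ^+ n.+2 * t2) + 1 +
      delta^-1 * (`|2 * (B / S) * tau^-1 ^+ n.+1| * d) `^ q.
Proof.
move=> q1 delta0 nq B1 Bq e12 sg0 /andP[sgt tau1] /andP[S0 S1] S2 d0 sk /andP[t0 t22].
have tau0 : 0 < tau by apply: lt_le_trans sgt.
have B0 : 0 < B by apply: lt_le_trans B1.
have n0 : 0 < n.+1%:R :> R by rewrite ltr0n.
have [B0' S0' tau0' n0' sg0'] : [/\ 0 <= B, 0 <= S, 0 <= tau, 0 <= n.+1%:R :> R & 0 <= sg].
  by split; apply: ltW.
have [tauV0 sgV0] : 0 <= tau^-1 /\ 0 <= sg^-1 by rewrite !invr_ge0.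
have [X XE] : exists X, X = n.+1%:R * tau^-1 ^+ n.+2 by eexists.
have X0 : 0 < X by rewrite XE mulr_gt0// exprn_gt0// invr_gt0.
have X0' := ltW X0.
have -> : 2 * B * S * (- n.+1%:R * tau^-1 ^+ n.+2 * t2) = - (2 * B * S * X * t2).
  by rewrite XE; ring.
have bound : 2 * B * S * X * t2 <= 4 * B * S * X.
  have -> : 4 * B * S * X = 2 * B * S * X * 2 by ring.
  by rewrite ler_wpM2l// !mulr_ge0.
have P0 : 0 <= 2 * (B / S) * tau^-1 ^+ n.+1.
  by rewrite !mulr_ge0 ?exprn_ge0// invr_ge0.
rewrite ger0_norm//.
have [sd|ds] := leP s (d ^+ 2).
  have Sd : S <= 2 * d.
    apply: ler_of_sqr; first by rewrite mulr_ge0.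
    by rewrite S2 exprMn; have := sqr_ge0 d; lra.
  have Ld : B * tau^-1 ^+ n.+1 <= 2 * (B / S) * tau^-1 ^+ n.+1 * d.
    have -> : 2 * (B / S) * tau^-1 ^+ n.+1 * d = (B * tau^-1 ^+ n.+1) * (2 * d / S) by ring.
    rewrite ler_peMr//.
      by rewrite mulr_ge0 ?exprn_ge0.
    by rewrite ler_pdivlMr// mul1r.
  have pw : (B * tau^-1 ^+ n.+1) `^ q <= (2 * (B / S) * tau^-1 ^+ n.+1 * d) `^ q.
    apply: ge0_ler_powR; rewrite ?nnegrE.
    - lra.
    - by rewrite mulr_ge0 ?exprn_ge0.
    - by rewrite mulr_ge0.
    - exact: Ld.
  have dv : 0 <= delta^-1 by rewrite invr_ge0 ltW.
  have := ler_wpM2l dv pw.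
  have := superlinear_absorbs q delta B tau n.+1 q1 delta0 nq B1 Bq.
  rewrite tau0 tau1 => /(_ isT) sup1.
  have BSX : 4 * B * S * X <= 4 * n.+1%:R * B * tau^-1 ^+ n.+2.
    have -> : 4 * n.+1%:R * B * tau^-1 ^+ n.+2 = 4 * B * X by rewrite XE; ring.
    have -> : 4 * B * S * X = 4 * B * X * S by ring.
    by rewrite ler_piMr// !mulr_ge0.
  lra.
set kap := sg ^+ n.+2 / (16 * B * n.+1%:R) in sk.
have kap0 : 0 < kap by rewrite divr_gt0 ?exprn_gt0// !mulr_gt0.
have Sk : S <= kap by apply: ler_of_sqr; [exact: ltW|rewrite S2; lra].
have Xle : X <= n.+1%:R * sg^-1 ^+ n.+2.
  rewrite XE ler_wpM2l ?(ltW n0)// lerXn2r ?nnegrE ?invr_ge0 ?(ltW sg0) ?(ltW tau0)//.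
  by rewrite lef_pV2 ?posrE.
have b1 : 4 * B * S * X <= 4 * B * kap * (n.+1%:R * sg^-1 ^+ n.+2).
  apply: ler_pM => //; rewrite ?(ltW X0)//.
    by rewrite !mulr_ge0.
  by rewrite ler_wpM2l// mulr_ge0.
have b2 : 4 * B * kap * (n.+1%:R * sg^-1 ^+ n.+2) = 1/4.
  rewrite /kap exprVn; field.
  by rewrite expf_neq0 ?gt_eqF.
have : 0 <= delta^-1 * (2 * (B / S) * tau^-1 ^+ n.+1 * d) `^ q.
  by rewrite mulr_ge0 ?powR_ge0// invr_ge0 ltW.
lra.
Qed.
End calculus.

(** * The spreading cone and the decay from a low point *)

Section spreading.
Context {R : realType} {N : nat}.

Lemma continuous_lt_nearby (v : 'rV[R]_N * R -> R) (y : 'rV[R]_N) (s b : R) :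
  {for (y, s), continuous v} -> v (y, s) < b ->
  exists2 rho : R, 0 < rho & forall x, nsq (x - y) < rho ^+ 2 -> v (x, s) < b.
Proof.
move=> vc vb.
have : \forall a \near (y, s), v a < b by exact: (cvgr_lt (v (y, s)) vc).
case/nbhs_ballP => rho /= rho0 H; exists rho => // x xy.
apply: H; split => /=; last exact: ballxx.
split => // i j.
rewrite ord1 -ball_normE /ball_ /= distrC.
rewrite -(ltr_pXn2r (_ : (0 < 2)%N)) ?nnegrE ?(ltW rho0)//.
rewrite real_normK ?num_real//.
by have := nsq_coord (x - y) j; rewrite !mxE => /le_lt_trans; apply.
Qed.

(** A cone in space whose slope blows up like a negative power of the elapsed
    time and which rises at unit speed. The parameter [sg] keeps the slope
    finite at the initial time [-1/16], and [s] smooths the tip. The elapsed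
    time enters squared so that the function is smooth on the whole line. *)
Definition spreading_cone (y : 'rV[R]_N) (B sg s : R) (n : nat) :
    'rV[R]_N * R -> R :=
  fun b => 2 * B * Num.sqrt (s + nsq (b.1 - y)) *
    (sg + (b.2 + 1/16) ^+ 2)^-1 ^+ n.+1 + (1/2 + (b.2 + 1/16)).

Lemma spreading_cone_C1 (y : 'rV[R]_N) (B sg s : R) (n : nat) :
  0 < sg -> 0 < s ->
  [/\ C1_on setT (spreading_cone y B sg s n),
   forall a, dt (spreading_cone y B sg s n) a =
     2 * B * Num.sqrt (s + nsq (a.1 - y)) *
       (- n.+1%:R * (sg + (a.2 + 1/16) ^+ 2)^-1 ^+ n.+2 * (2 * (a.2 + 1/16))) + 1 &
   forall a, grad_x (spreading_cone y B sg s n) a =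
     (2 * (B / Num.sqrt (s + nsq (a.1 - y))) *
       (sg + (a.2 + 1/16) ^+ 2)^-1 ^+ n.+1) *: (a.1 - y)].
Proof.
move=> sg0 s0.
pose tau (t : R) := sg + (t + 1/16) ^+ 2.
have tau_gt t : 0 < tau t by rewrite ltr_pwDl// sqr_ge0.
pose f (w : R) := 2 * B * Num.sqrt (s + w).
pose f' (w : R) := B / Num.sqrt (s + w).
pose g (t : R) := (tau t)^-1 ^+ n.+1.
pose g' (t : R) := - n.+1%:R * (tau t)^-1 ^+ n.+2 * (2 * (t + 1/16)).
pose k (t : R) := 1/2 + (t + 1/16).
pose k' : R -> R := cst 1.
have fd (w : R) : 0 <= w -> is_derive w 1 f (f' w) by exact: is_derive_sqrt_shift.
have gd (t : R) : is_derive t 1 g (g' t) by exact: is_derive_inv_sqr_shiftX.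
have kd (t : R) : is_derive t 1 k (k' t).
  by apply: is_derive_eq; rewrite add0r ?addr0 ?mulr1.
have tauc : continuous tau.
  by move=> t; apply: differentiable_continuous; apply/derivable1_diffP.
have f'c (w : R) : 0 <= w -> {for w, continuous f'}.
  move=> w0; apply: cvgM; first exact: cvg_cst.
  apply: cvgV; first by rewrite gt_eqF// sqrtr_gt0 ltr_wpDr.
  apply: continuous_comp; last exact: sqrt_continuous.
  by apply: cvgD; [exact: cvg_cst|exact: cvg_id].
have g'c : continuous g'.
  move=> t; apply: cvgM; last first.
    by apply: cvgM; [exact: cvg_cst|apply: cvgD; [exact: cvg_id|exact: cvg_cst]].
  apply: cvgM; first exact: cvg_cst.
  apply: (@continuous_comp _ _ _ (fun t => (tau t)^-1) (fun z => z ^+ n.+2)).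
    by apply: cvgV; [rewrite gt_eqF|exact: tauc].
  exact: exprn_continuous.
exact: (@radial_C1 R N y f g k f' g' k' fd gd kd f'c g'c (@cst_continuous _ _ _)).
Qed.

Lemma elapsed_time_le1 (sg t : R) : sg <= 1/2 -> -1/16 <= t <= 1/2 ->
  sg + (t + 1/16) ^+ 2 <= 1.
Proof.
move=> sg12 /andP[t1 t2].
have : (t + 1/16) ^+ 2 <= (9/16) ^+ 2 by rewrite ler_pXn2r ?nnegrE//; lra.
lra.
Qed.

Lemma spreading_cone_strict (q delta e : R) (y : 'rV[R]_N) (B sg s : R) (n : nat) a :
  1 < q -> 0 < delta -> 1 <= n.+1%:R * (q - 1) -> 1 <= B ->
  4 * n.+1%:R * delta <= B `^ (q - 1) -> e <= 1/2 ->
  0 < sg <= 1/2 -> 0 < s <= 1/2 ->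
  s <= (sg ^+ n.+2 / (16 * B * n.+1%:R)) ^+ 2 / 2 ->
  nsq (a.1 - y) < 1/4 -> -1/16 < a.2 < 1/2 ->
  e < dt (spreading_cone y B sg s n) a +
      delta^-1 * enorm (grad_x (spreading_cone y B sg s n) a) `^ q.
Proof.
move=> q1 delta0 nq B1 Bq e12 /andP[sg0 sg12] /andP[s0 s12] sk ar /andP[a1 a2].
have [_ -> ->] := spreading_cone_C1 y B sg s n sg0 s0; rewrite enormZ.
have n0 := nsq_ge0 (a.1 - y).
have S2 : Num.sqrt (s + nsq (a.1 - y)) ^+ 2 = s + nsq (a.1 - y).
  by rewrite sqr_sqrtr// addr_ge0// ltW.
apply: (@cone_strict _ q delta B e _ sg _ _ s _ n) => //.
- rewrite elapsed_time_le1 ?andbT//; first by rewrite lerDl sqr_ge0.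
  by apply/andP; split; apply: ltW.
- rewrite sqrtr_gt0 ltr_wpDr//=; apply: ler_of_sqr => //.
  rewrite S2; clear -ar s12; lra.
- by rewrite S2 enorm_sqr.
- exact: enorm_ge0.
- by clear -a1 a2; apply/andP; split; lra.
Qed.

(** On the lateral side the cone exceeds [1] by its slope, at the final time by
    its rise, and at the initial time by its slope except close to [y], where
    [v] is below [1/2]. *)
Lemma spreading_cone_boundary (v : 'rV[R]_N * R -> R) (y : 'rV[R]_N)
    (B sg s rho : R) (n : nat) a :
  1 <= B -> 0 < sg <= 1/2 -> 0 < s -> sg <= rho ->
  (forall x, nsq (x - y) < rho ^+ 2 -> v (x, -1/16) < 1/2) ->
  v a <= 1 -> -1/16 <= a.2 <= 1/2 ->
  nsq (a.1 - y) = 1/4 \/ a.2 = -1/16 \/ a.2 = 1/2 ->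
  v a <= spreading_cone y B sg s n a.
Proof.
move=> B1 /andP[sg0 sg12] s0 sgr low v1 at_ bd.
have B0 : 0 < B by apply: lt_le_trans B1.
have [as_ aT] := andP at_.
rewrite /spreading_cone; set S := Num.sqrt _; set tau := sg + _.
have ay0 := nsq_ge0 (a.1 - y).
have S2 : S ^+ 2 = s + nsq (a.1 - y) by rewrite sqr_sqrtr// addr_ge0// ltW.
have S0 : 0 <= S by exact: sqrtr_ge0.
have tau0 : 0 < tau by rewrite ltr_pwDl// sqr_ge0.
have tn1 : 1 <= tau^-1 ^+ n.+1.
  by apply: exprn_ege1; rewrite invf_ge1//; exact: elapsed_time_le1.
have BS0 : 0 <= 2 * B * S by rewrite !mulr_ge0// ltW.
have steep : 2 * B * S <= 2 * B * S * tau^-1 ^+ n.+1 by rewrite ler_peMr.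
case: bd => [E|[E|E]].
- have S12 : 1/2 <= S by apply: ler_of_sqr => //; rewrite S2 E; clear -s0; lra.
  have : B * (1/2) <= B * S by rewrite ler_wpM2l// ltW.
  clear -steep B1 v1 as_; lra.
- have [lt|ge] := ltP (nsq (a.1 - y)) (rho ^+ 2).
    have := low _ lt; rewrite -E -surjective_pairing.
    clear -steep BS0 as_; lra.
  have Sr : rho <= S by apply: ler_of_sqr => //; rewrite S2; clear -ge s0; lra.
  have tE : tau = sg by rewrite /tau E; ring.
  have : 1 <= S * tau^-1 ^+ n.+1.
    rewrite tE exprS mulrA; apply: mulr_ege1.
      by rewrite ler_pdivlMr// mul1r (le_trans sgr).
    by apply: exprn_ege1; rewrite invf_ge1//; clear -sg12; lra.
  move=> /(ler_wpM2l (ltW B0)); clear -v1 B1 as_; lra.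
- clear -steep BS0 v1 E; lra.
Qed.

(** The time lapse is at least [1/32], so the slope is at most
    [2 * B * 32 ^ (2 (n+1))] whatever the values of [sg] and [s]: this is where
    the estimate becomes independent of the modulus of continuity of the
    solution. *)
Lemma spreading_cone_small (y : 'rV[R]_N) (B sg s c : R) (n : nat) a :
  0 < B -> 0 < sg -> 0 < s -> s <= c ^+ 2 -> 0 < c ->
  48 * B * 32 ^+ (2 * n.+1) * c = 1 ->
  nsq (a.1 - y) <= 4 * c ^+ 2 -> -1/32 <= a.2 <= 1/32 ->
  spreading_cone y B sg s n a <= 3/4.
Proof.
move=> B0 sg0 s0 sc c0.
rewrite exprM -[32 ^+ 2]invrK -exprVn; set L : R := (32^-1) ^+ 2.
have L0 : 0 < L by rewrite exprn_gt0.
set K := L^-1 ^+ n.+1 => cB ar /andP[as_ aT].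
rewrite /spreading_cone; set S := Num.sqrt _; set tau := sg + _.
have S2 : S ^+ 2 = s + nsq (a.1 - y).
  by rewrite sqr_sqrtr// addr_ge0 ?nsq_ge0// ltW.
have S0 : 0 <= S by exact: sqrtr_ge0.
have S3 : S <= 3 * c.
  apply: ler_of_sqr; [clear -c0; lra|rewrite S2].
  have := sqr_ge0 c; clear -ar sc; lra.
have tau0 : 0 < tau by rewrite ltr_pwDl// sqr_ge0.
have Ltau : L <= tau.
  apply: (@le_trans _ _ ((a.2 + 1/16) ^+ 2)); last by rewrite lerDr ltW.
  by rewrite lerXn2r ?nnegrE//; clear -as_; lra.
have tK : tau^-1 ^+ n.+1 <= K.
  by rewrite lerXn2r ?nnegrE ?invr_ge0 ?(ltW tau0) ?(ltW L0)// lef_pV2.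
have : 2 * B * S * tau^-1 ^+ n.+1 <= 2 * B * (3 * c) * K.
  apply: ler_pM => //.
  - by rewrite !mulr_ge0// ltW.
  - by rewrite exprn_ge0// invr_ge0 ltW.
  - by rewrite ler_wpM2l// mulr_ge0// ltW.
have -> : 2 * B * (3 * c) * K = (48 * B * K * c) / 8 by field.
rewrite cB; clear -aT; lra.
Qed.

(** Comparison with the spreading cone: since the Hamiltonian is superlinear,
    one low value pulls a subsolution down on a whole neighbourhood of fixed
    size a fixed time later. *)
Lemma falls_near_low_point (q delta B e : R) (n : nat) (v : 'rV[R]_N * R -> R)
    (y : 'rV[R]_N) :
  1 < q -> 0 < delta -> 1 <= n.+1%:R * (q - 1) -> 1 <= B ->
  4 * n.+1%:R * delta <= B `^ (q - 1) -> e <= 1/2 ->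
  (forall a, cyl y (1/4) (-1/16) (1/2) a -> {for a, continuous v}) ->
  sub_on (cyl y (1/4) (-1/16) (1/2)) delta^-1 q e v ->
  (forall a, cyl y (1/4) (-1/16) (1/2) a -> v a <= 1) ->
  v (y, -1/16) < 1/2 ->
  forall c, 0 < c <= 1/48 -> 48 * B * 32 ^+ (2 * n.+1) * c = 1 ->
  forall a, nsq (a.1 - y) <= 4 * c ^+ 2 -> -1/32 <= a.2 <= 1/32 -> v a <= 3/4.
Proof.
move=> q1 delta0 nq B1 Bq e12 vc vs v1 vlow c /andP[c0 c48] cB a ar /andP[as_ aT].
have B0 : 0 < B by apply: lt_le_trans B1.
have c2 : c ^+ 2 <= (1/48) ^+ 2.
  by rewrite ler_pXn2r ?nnegrE//; clear -c0; lra.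
have Dlow : cyl y (1/4) (-1/16) (1/2) (y, -1/16).
  split => /=; last by clear; apply/andP; split; lra.
  by rewrite subrr /nsq big1 ?divr_ge0// => i _; rewrite mxE expr0n.
have [rho rho0 low] := continuous_lt_nearby _ _ _ _ (vc _ Dlow) vlow.
have [sg [sg0 sg12 sgr]] : exists sg, [/\ 0 < sg, sg <= 1/2 & sg <= rho].
  exists (Num.min (1/2) rho); rewrite lt_min rho0 !ge_min !lexx orbT andbT.
  by split => //; rewrite divr_gt0.
pose kap := sg ^+ n.+2 / (16 * B * n.+1%:R).
have kap0 : 0 < kap by rewrite divr_gt0 ?exprn_gt0// !mulr_gt0// ltr0n.
have [s [s0 sk sc]] : exists s, [/\ 0 < s, s <= kap ^+ 2 / 2 & s <= c ^+ 2].
  exists (Num.min (kap ^+ 2 / 2) (c ^+ 2)).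
  by rewrite lt_min !ge_min !lexx orbT divr_gt0 ?exprn_gt0.
have [C1 _ _] := spreading_cone_C1 y B sg s n sg0 s0.
apply: (@le_trans _ _ (spreading_cone y B sg s n a)); last first.
  apply: spreading_cone_small cB ar _ => //.
  by rewrite as_.
apply: (sub_comparison y (1/4) (-1/16) (1/2) delta^-1 q e v _ C1 vc vs).
- move=> b br bt; apply: spreading_cone_strict => //.
    by rewrite sg0.
  by rewrite s0 /=; clear -sc c2; lra.
- move=> b Db bd; apply: (@spreading_cone_boundary v y B sg s rho) => //.
  + by rewrite sg0.
  + exact: v1.
  + by case: Db.
- split; last by clear -as_ aT; apply/andP; split; lra.
  apply: (le_trans ar); clear -c2; lra.
Qed.
End spreading.

(** * Decrease of the oscillation at unit scale *)

Section oscillation.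
Context {R : realType} {N : nat}.

Lemma sub_onW (Q Q' : set ('rV[R]_N * R)) c q e e' u :
  Q' `<=` Q -> e <= e' -> sub_on Q c q e u -> sub_on Q' c q e' u.
Proof. by move=> QQ ee h phi a C1 /QQ Qa lm; apply: le_trans (h _ _ C1 Qa lm) ee. Qed.

Lemma super_onW (Q Q' : set ('rV[R]_N * R)) c q e e' u :
  Q' `<=` Q -> e <= e' -> super_on Q c q e u -> super_on Q' c q e' u.
Proof.
move=> QQ ee h phi a C1 /QQ Qa lm; apply: le_trans (h _ _ C1 Qa lm).
by rewrite lerN2.
Qed.

(** Isolated as a predicate because its constants are chosen before the solution,
    so that they serve all solutions and all scales. *)
Definition oscillation_drops (q delta kap lam e0 : R) :=
  forall v : 'rV[R]_N * R -> R,
    (forall a, cyl 0 1 (-1) 1 a -> {for a, continuous v}) ->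
    sub_on (cyl 0 1 (-1) 1) delta^-1 q e0 v ->
    super_on (cyl 0 1 (-1) 1) delta q e0 v ->
    (forall a, cyl 0 1 (-1) 1 a -> 0 <= v a <= 1) ->
    (forall a, cyl 0 (lam ^+ 2) (- lam) lam a -> v a <= 1 - kap) \/
    (forall a, cyl 0 (lam ^+ 2) (- lam) lam a -> kap <= v a).

(** Either some value of [v] at time [-1/16] near the origin is below [1/2], and
    it propagates forward as an upper bound, or all of them are above [1/2], and
    the positivity survives. The two barriers must agree on the size [c] of the
    neighbourhood; [c] is fixed by the first one, and the height [mu] of the
    second one is then taken small, which superlinearity allows. *)
Lemma oscillation_step (q delta : R) : 1 < q -> 0 < delta ->
  exists kap lam e0 : R, [/\ 0 < kap <= 1/4, 0 < lam <= 1/32, 0 < e0 &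
    oscillation_drops q delta kap lam e0].
Proof.
move=> q1 delta0.
have q10 : 0 < q - 1 by rewrite subr_gt0.
have qn0 : q - 1 != 0 by rewrite gt_eqF.
have [n nq] : exists n : nat, 1 <= n.+1%:R * (q - 1).
  exists (Num.truncn (q - 1)^-1).
  by rewrite -ler_pdivrMr// div1r ltW//; exact: truncnS_gt.
have n0 : 0 < n.+1%:R :> R by rewrite ltr0n.
pose X := 4 * n.+1%:R * delta.
have X0 : 0 < X by rewrite !mulr_gt0.
pose B := Num.max 1 (X `^ (q - 1)^-1).
have B1 : 1 <= B by rewrite le_max lexx.
have BX : X `^ (q - 1)^-1 <= B by rewrite le_max lexx orbT.
have Bq : X <= B `^ (q - 1).
  have -> : X = (X `^ (q - 1)^-1) `^ (q - 1) by rewrite -powRrM mulVf// powRr1// ltW.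
  by apply: ge0_ler_powR; rewrite ?nnegrE ?powR_ge0// (ltW q10, le_trans _ B1).
pose c : R := (48 * B * 32 ^+ (2 * n.+1))^-1.
have B0 : 0 < B by apply: lt_le_trans B1.
have K1 : 1 <= 32 ^+ (2 * n.+1) :> R by apply: exprn_ege1; lra.
have K0 : 0 < 32 ^+ (2 * n.+1) :> R by apply: lt_le_trans K1.
have c0 : 0 < c by rewrite invr_gt0 !mulr_gt0.
have c1 : c <= 1/48.
  rewrite div1r lef_pV2 ?posrE ?mulr_gt0// -mulrA ler_peMr// mulr_ege1//.
have cB : 48 * B * 32 ^+ (2 * n.+1) * c = 1 by rewrite mulfV// gt_eqF// !mulr_gt0.
have c2 : c ^+ 2 <= (1/48) ^+ 2 by rewrite lerXn2r ?nnegrE//; clear -c0; lra.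
(* [m] is the slope bound [2 * mu / c] of the second barrier *)
pose m := Num.min 1 ((c / (4 * delta)) `^ (q - 1)^-1).
have Y0 : 0 < c / (4 * delta) by rewrite divr_gt0// mulr_gt0.
have m0 : 0 < m by rewrite lt_min ltr01 powR_gt0.
have m1 : m <= 1 by rewrite ge_min lexx.
have mY : m <= (c / (4 * delta)) `^ (q - 1)^-1 by rewrite ge_min lexx orbT.
have mq : m `^ (q - 1) <= c / (4 * delta).
  have -> : c / (4 * delta) = ((c / (4 * delta)) `^ (q - 1)^-1) `^ (q - 1).
    by rewrite -powRrM mulVf// powRr1// ltW.
  by apply: ge0_ler_powR; rewrite ?nnegrE ?powR_ge0// (ltW q10, ltW m0).
pose mu := c / 2 * m.
have mu0 : 0 < mu by rewrite mulr_gt0// divr_gt0.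
have mu12 : mu <= 1/2.
  have : c / 2 * m <= c / 2 by rewrite ler_piMr// ltW// divr_gt0.
  by rewrite -/mu; clear -c1; lra.
have small : delta * (2 * mu / c) `^ q <= mu / 2.
  have -> : 2 * mu / c = m by rewrite /mu; field; rewrite gt_eqF.
  rewrite (powR_mul_powRB1 _ _ m0).
  have -> : mu / 2 = delta * (m * (c / (4 * delta))).
    by rewrite /mu; field; rewrite gt_eqF.
  by rewrite !ler_pM2l.
exists (mu / 2), (c / 2), mu; split.
- by clear -mu0 mu12; apply/andP; split; lra.
- by clear -c0 c1; apply/andP; split; lra.
- exact: mu0.
move=> v vc vsub vsup v01.
have [[y [yc vy]]|nex] := pselect (exists y, nsq y <= c ^+ 2 /\ v (y, -1/16) < 1/2).
  left=> a [ar /andP[as_ aT]].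
  have sub1 : cyl y (1/4) (-1/16) (1/2) `<=` cyl 0 1 (-1) 1.
    move=> b [br /andP[bs bT]]; split.
      have := nsqD_le (b.1 - y) y; rewrite subrK subr0.
      clear -br yc c2; lra.
    by clear -bs bT; apply/andP; split; lra.
  apply: (@le_trans _ _ (3/4)); last by clear -mu12; lra.
  apply: (@falls_near_low_point _ _ q delta B mu n v y q1 delta0 nq B1 Bq mu12 _ _ _ vy c).
  - by move=> b /sub1; exact: vc.
  - exact: sub_onW sub1 _ vsub.
  - by move=> b /sub1 /v01 /andP[].
  - by rewrite c0 c1.
  - exact: cB.
  - have := nsqD_le a.1 (- y); rewrite nsqN; move: ar; rewrite subr0 => ar.
    have : (c / 2) ^+ 2 = c ^+ 2 / 4 by field.
    have := sqr_ge0 c; clear -ar yc; lra.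
  - by clear -as_ aT c1; apply/andP; split; lra.
right=> a [ar /andP[as_ aT]].
have sub1 : cyl (0 : 'rV[R]_N) (c ^+ 2) (-1/16) (1/2) `<=` cyl 0 1 (-1) 1.
  move=> b [br /andP[bs bT]]; split.
    by apply: le_trans br _; clear -c2; lra.
  by clear -bs bT; apply/andP; split; lra.
apply: (@grows_from_lower_bound _ _ q delta c mu mu v) => //.
- by clear -q1; lra.
- exact: ltW.
- by rewrite mu0.
- by move=> b /sub1; exact: vc.
- exact: super_onW sub1 _ vsup.
- by move=> b /sub1 /v01 /andP[].
- by move=> x xc; rewrite leNgt; apply/negP => vx; apply: nex; exists x.
- by move: ar; rewrite subr0.
- by clear -as_ aT c1; apply/andP; split; lra.
Qed.
End oscillation.

(** * Change of scale *)

Section scaling.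
Context {R : realType} {N : nat}.
Context (x0 : 'rV[R]_N) (t0 r T : R).
Context (r0 : 0 < r) (T0 : 0 < T).

Definition zoom (b : 'rV[R]_N * R) : 'rV[R]_N * R :=
  (r^-1 *: (b.1 - x0), T^-1 * (b.2 - t0)).

Definition unzoom (b : 'rV[R]_N * R) : 'rV[R]_N * R :=
  (x0 + r *: b.1, t0 + T * b.2).

Lemma unzoomK : cancel unzoom zoom.
Proof.
move=> [x t]; rewrite /zoom /unzoom /=; congr (_, _).
  by rewrite addrC addKr scalerA mulVf ?gt_eqF// scale1r.
by rewrite addrC addKr mulKf// gt_eqF.
Qed.

Lemma zoomK : cancel zoom unzoom.
Proof.
move=> [x t]; rewrite /zoom /unzoom /=; congr (_, _).
  by rewrite scalerA mulfV ?gt_eqF// scale1r addrC subrK.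
by rewrite mulVKf ?gt_eqF// addrC subrK.
Qed.

Lemma unzoom_continuous : continuous unzoom.
Proof.
move=> b.
have h1 : (x0 + r *: z.1) @[z --> b] --> x0 + r *: b.1.
  by apply: cvgD; [exact: cvg_cst|apply: cvgZr; exact: cvg_fst].
have h2 : (t0 + T * z.2) @[z --> b] --> t0 + T * b.2.
  by apply: cvgD; [exact: cvg_cst|apply: cvgMr; exact: cvg_snd].
exact: (cvg_pair h1 h2).
Qed.

Lemma zoom_is_diff (a : 'rV[R]_N * R) :
  is_diff a zoom (fun v => (r^-1 *: v.1, T^-1 * v.2)).
Proof.
pose l (b : 'rV[R]_N * R) : 'rV[R]_N * R := (r^-1 *: b.1, T^-1 * b.2).
have lin_l : linear l.
  move=> c u v; rewrite /l /=; congr (_, _).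
    by rewrite scalerDr scalerA [r^-1 * c]mulrC -scalerA.
  change (T^-1 * (c * u.2 + v.2) = c * (T^-1 * u.2) + T^-1 * v.2); ring.
pose lM := GRing.isLinear.Build _ _ _ _ _ lin_l.
pose lL : {linear _ -> _} := HB.pack l lM.
have lc : continuous lL.
  move=> b.
  have h1 : (r^-1 *: z.1) @[z --> b] --> r^-1 *: b.1 by apply: cvgZr; exact: cvg_fst.
  have h2 : (T^-1 * z.2) @[z --> b] --> T^-1 * b.2 by apply: cvgMr; exact: cvg_snd.
  exact: (cvg_pair h1 h2).
have dl : is_diff a l l.
  have dL : differentiable lL a by exact: linear_differentiable.
  by apply: DiffDef => //; rewrite -[LHS]/('d lL a : _ -> _) diff_lin.
have -> : zoom = l + cst (r^-1 *: - x0, T^-1 * - t0).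
  by apply/funext => b; rewrite /zoom scalerDr mulrDr.
apply: (is_diff_eq (is_diffD dl (is_diff_cst _ a))); exact: addr0.
Qed.

Lemma zoom_continuous : continuous zoom.
Proof. by move=> a; apply: differentiable_continuous; case: (zoom_is_diff a). Qed.

Lemma zoom_C1 (phi : 'rV[R]_N * R -> R) (m w : R) : C1_on setT phi ->
  let psi := fun b => m + w * phi (zoom b) in
  [/\ C1_on setT psi,
    forall a, dt psi a = w / T * dt phi (zoom a) &
    forall a, grad_x psi a = (w / r) *: grad_x phi (zoom a)].
Proof.
move=> C1 psi; have [d dc gc] := C1.
have Pd a : is_diff a psi (fun v => w * 'd phi (zoom a) (r^-1 *: v.1, T^-1 * v.2)).
  have dz := zoom_is_diff a.
  have dp : is_diff (zoom a) phi ('d phi (zoom a)) by apply: DiffDef => //; exact: d.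
  have dcmp := is_diff_comp dz dp.
  have -> : psi = cst m + w *: (phi \o zoom) by apply/funext.
  have dw := @is_diffZ R _ _ _ _ w a dcmp.
  apply: (is_diff_eq (is_diffD (is_diff_cst m a) dw)); apply/funext => v.
  exact: add0r.
have dE a v : 'D_v psi a = w * 'D_(r^-1 *: v.1, T^-1 * v.2) phi (zoom a).
  have [dpa dpE] := Pd a.
  rewrite (deriveE _ dpa) dpE (deriveE _ (d _ _))//.
have dtE a : dt psi a = w / T * dt phi (zoom a).
  rewrite /dt dE /=; have -> : (r^-1 *: (0 : 'rV[R]_N), T^-1 * 1) = T^-1 *: (0, 1) :> 'rV[R]_N * R.
    by apply/pair_equal_spec; split; rewrite //= !scaler0.
  by rewrite !(deriveE _ (d _ _))// linearZ /= mulrA.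
have gE a : grad_x psi a = (w / r) *: grad_x phi (zoom a).
  apply/rowP => i; rewrite !mxE dE /=.
  have -> : (r^-1 *: delta_mx 0 i, T^-1 * 0) = r^-1 *: (delta_mx 0 i, 0) :> 'rV[R]_N * R.
    by apply/pair_equal_spec; split; rewrite //= mulr0 scaler0.
  by rewrite !(deriveE _ (d _ _))// linearZ /= mulrA.
have dcc : continuous (dt phi) by apply/continuous_subspace_setT.
have gcc : continuous (grad_x phi) by apply/continuous_subspace_setT.
split; [split|exact: dtE|exact: gE].
- by move=> a _; case: (Pd a).
- rewrite (_ : dt psi = fun a => w / T * dt phi (zoom a)); last exact/funext.
  apply: continuous_subspaceT => a; apply: cvgMr.
  exact: (continuous_comp (zoom_continuous a) (dcc (zoom a))).
- rewrite (_ : grad_x psi = fun a => (w / r) *: grad_x phi (zoom a)); last exact/funext.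
  apply: continuous_subspaceT => a; apply: cvgZr.
  exact: (continuous_comp (zoom_continuous a) (gcc (zoom a))).
Qed.

Context (m w q : R).
Context (w0 : 0 < w) (scale_eq : (w / r) `^ q = w / T).

(** A test function [phi] of the rescaled function gives the test function
    [m + w phi (zoom b)] of [u], whose time derivative carries the factor [w / T]
    and whose gradient the factor [w / r]. By the relation between [w], [r] and [T]
    the whole left-hand side is multiplied by [w / T]. *)
Lemma zoom_sub_on (Q : set ('rV[R]_N * R)) c e u :
  sub_on Q c q e u ->
  sub_on (unzoom @^-1` Q) c q (e * T / w) (fun b => (u (unzoom b) - m) / w).
Proof.
move=> us phi a C1 Qa lm.
have [C1' dtE gE] := zoom_C1 phi m w C1.
have lm' : local_max (fun b => u b - (m + w * phi (zoom b))) (unzoom a).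
  rewrite /local_max in lm *; rewrite -{1}(unzoomK a) in lm.
  have := zoom_continuous (unzoom a) _ lm => H.
  near=> b; have : (u (unzoom (zoom b)) - m) / w - phi (zoom b) <= (u (unzoom a) - m) / w - phi a.
    by near: b.
  rewrite zoomK unzoomK -(ler_pM2l w0) !mulrBr ![w * (_ / w)]mulrC !divfK ?gt_eqF//; lra.
have := us _ _ C1' Qa lm'.
rewrite dtE gE unzoomK enormZ ger0_norm ?divr_ge0 ?(ltW w0) ?(ltW r0)//.
rewrite powRM ?divr_ge0 ?(ltW w0) ?(ltW r0) ?enorm_ge0// scale_eq => h.
rewrite ler_pdivlMr// -ler_pdivrMr//; apply: le_trans h.
by rewrite le_eqVlt; apply/orP; left; apply/eqP; ring.
Unshelve. all: end_near. Qed.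

Lemma zoom_super_on (Q : set ('rV[R]_N * R)) c e u :
  super_on Q c q e u ->
  super_on (unzoom @^-1` Q) c q (e * T / w) (fun b => (u (unzoom b) - m) / w).
Proof.
move=> us phi a C1 Qa lm.
have [C1' dtE gE] := zoom_C1 phi m w C1.
have lm' : local_min (fun b => u b - (m + w * phi (zoom b))) (unzoom a).
  rewrite /local_min in lm *; rewrite -{1}(unzoomK a) in lm.
  have := zoom_continuous (unzoom a) _ lm => H.
  near=> b; have : (u (unzoom a) - m) / w - phi a <= (u (unzoom (zoom b)) - m) / w - phi (zoom b).
    by near: b.
  rewrite zoomK unzoomK -(ler_pM2l w0) !mulrBr ![w * (_ / w)]mulrC !divfK ?gt_eqF//; lra.
have := us _ _ C1' Qa lm'.
rewrite dtE gE unzoomK enormZ ger0_norm ?divr_ge0 ?(ltW w0) ?(ltW r0)//.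
rewrite powRM ?divr_ge0 ?(ltW w0) ?(ltW r0) ?enorm_ge0// scale_eq => h.
rewrite -mulNr -mulNr ler_pdivrMr// -ler_pdivlMr//; apply: (le_trans h).
by rewrite le_eqVlt; apply/orP; left; apply/eqP; ring.
Unshelve. all: end_near. Qed.

End scaling.

(** * Decay of the oscillation at all scales *)

Section decay.
Context {R : realType} {N : nat}.

Definition ccyl (x : 'rV[R]_N) (t r T : R) := cyl x (r ^+ 2) (t - T) (t + T).

Lemma ccylW x t r r' T T' : 0 <= r -> r <= r' -> T <= T' -> ccyl x t r T `<=` ccyl x t r' T'.
Proof.
move=> r0 rr TT a [ar /andP[as_ aT]]; split.
  by apply: (le_trans ar); rewrite lerXn2r ?nnegrE// (le_trans r0).
by clear -as_ aT TT; apply/andP; split; lra.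
Qed.

Lemma unzoom_ccyl x t r T l b : 0 < r -> 0 < T ->
  ccyl x t (l * r) (l * T) (unzoom x t r T b) <-> cyl 0 (l ^+ 2) (- l) l b.
Proof.
move=> r0 T0; rewrite /ccyl /cyl /unzoom /= [x + _]addrC addrK nsqZ subr0 exprMn mulrC.
rewrite ler_pM2r ?exprn_gt0//.
have -> : (t - l * T <= t + T * b.2) = (- l <= b.2).
  by rewrite lerD2l -mulNr [T * _]mulrC ler_pM2r.
have -> : (t + T * b.2 <= t + l * T) = (b.2 <= l).
  by rewrite lerD2l [T * _]mulrC ler_pM2r.
by [].
Qed.

Lemma distr_le_itv (c w x z : R) : c <= x <= c + w -> c <= z <= c + w -> `|x - z| <= w.
Proof.
by move=> /andP[? ?] /andP[? ?]; rewrite ler_norml; apply/andP; split; lra.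
Qed.

(** Heights [w], radii [r] and durations [T] with [(w / r) ^ q = w / T] leave
    both growth inequalities unchanged, and the errors get multiplied by
    [T / w]. *)
Lemma oscillation_step_scaled q delta kap lam e0 e u x t r T m w :
  @oscillation_drops R N q delta kap lam e0 -> 0 < lam <= 1 -> 0 < r -> 0 < T -> 0 < w ->
  (w / r) `^ q = w / T -> e * T / w <= e0 ->
  (forall a, ccyl x t r T a -> {for a, continuous u}) ->
  sub_on (ccyl x t r T) delta^-1 q e u ->
  super_on (ccyl x t r T) delta q e u ->
  (forall a, ccyl x t r T a -> m <= u a <= m + w) ->
  exists m', forall a, ccyl x t (lam * r) (lam * T) a -> m' <= u a <= m' + (1 - kap) * w.
Proof.
move=> step /andP[lam0 lam1] r0 T0 w0 sc ee uc us up ub.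
have sub : ccyl x t (lam * r) (lam * T) `<=` ccyl x t r T.
  apply: ccylW; first by rewrite mulr_ge0 ?(ltW lam0) ?(ltW r0).
  - by rewrite ler_piMl// ltW.
  - by rewrite ler_piMl// ltW.
pose v b := (u (unzoom x t r T b) - m) / w.
have QE b : cyl 0 1 (-1) 1 b -> ccyl x t r T (unzoom x t r T b).
  have := unzoom_ccyl x t r T 1 b r0 T0; rewrite !mul1r expr1n.
  by move=> [_ h]; exact: h.
have wv b : u (unzoom x t r T b) = m + w * v b.
  by rewrite /v; field; rewrite gt_eqF.
have := step v; case.
- move=> b Qb; apply: cvgM; last exact: cvg_cst.
  apply: cvgB; last exact: cvg_cst.
  exact: (continuous_comp (unzoom_continuous x t r T b) (uc _ (QE _ Qb))).
- apply: (sub_onW _ _ _ _ _ _ _ _ ee (zoom_sub_on x t r T r0 T0 m w q w0 sc _ _ _ _ us)) => b.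
  exact: QE.
- apply: (super_onW _ _ _ _ _ _ _ _ ee (zoom_super_on x t r T r0 T0 m w q w0 sc _ _ _ _ up)) => b.
  exact: QE.
- move=> b /QE /ub; rewrite wv => /andP[h1 h2].
  by apply/andP; split; rewrite -(ler_pM2l w0); lra.
- move=> small; exists m => a h; have aQ := sub a h.
  move: h; rewrite -{1}(zoomK x t r T r0 T0 a) => h.
  have [h1 _] := unzoom_ccyl x t r T lam (zoom x t r T a) r0 T0.
  have := ler_wpM2l (ltW w0) (small _ (h1 h)).
  have := wv (zoom x t r T a); rewrite zoomK// => E.
  rewrite E; move: (ub a aQ); rewrite E => /andP[? ?] ?; apply/andP; split; lra.
- move=> large; exists (m + kap * w) => a h; have aQ := sub a h.
  move: h; rewrite -{1}(zoomK x t r T r0 T0 a) => h.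
  have [h1 _] := unzoom_ccyl x t r T lam (zoom x t r T a) r0 T0.
  have := ler_wpM2l (ltW w0) (large _ (h1 h)).
  have := wv (zoom x t r T a); rewrite zoomK// => E.
  rewrite E; move: (ub a aQ); rewrite E => /andP[? ?] ?; apply/andP; split; lra.
Qed.

(** The cylinders shrink by [l] in space and by [b] in time while the oscillation
    shrinks by [1 - kap]; the relation between the three ratios keeps the scaling
    of [oscillation_step_scaled], and [b <= 1 - kap] keeps the errors small. *)
Lemma oscillation_decay q delta kap lam e0 e u x t r T m w l b :
  @oscillation_drops R N q delta kap lam e0 -> 0 < r -> 0 < T -> 0 < w -> 0 <= e ->
  0 < kap < 1 -> 0 < l <= lam -> 0 < b <= lam -> lam <= 1 ->
  ((1 - kap) / l) `^ q = (1 - kap) / b -> b <= 1 - kap ->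
  (w / r) `^ q = w / T -> e * T / w <= e0 ->
  (forall a, ccyl x t r T a -> {for a, continuous u}) ->
  sub_on (ccyl x t r T) delta^-1 q e u ->
  super_on (ccyl x t r T) delta q e u ->
  (forall a, ccyl x t r T a -> m <= u a <= m + w) ->
  forall k, exists m', forall a, ccyl x t (r * l ^+ k) (T * b ^+ k) a ->
    m' <= u a <= m' + w * (1 - kap) ^+ k.
Proof.
move=> step r0 T0 w0 e_ge0 /andP[k0 k1] /andP[l0 ll] /andP[b0 bl] l1 mueq bmu sc ee uc us up ub.
have l1' : l <= 1 by lra.
have b1' : b <= 1 by lra.
have lam01 : 0 < lam <= 1 by apply/andP; split; lra.
elim=> [|k [m' IH]]; first by exists m => a; rewrite !expr0 !mulr1; exact: ub.
have mu0 : 0 < 1 - kap by lra.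
set rk := r * l ^+ k; set Tk := T * b ^+ k; set wk := w * (1 - kap) ^+ k.
have rk0 : 0 < rk by rewrite mulr_gt0// exprn_gt0.
have Tk0 : 0 < Tk by rewrite mulr_gt0// exprn_gt0.
have wk0 : 0 < wk by rewrite mulr_gt0// exprn_gt0.
have rkr : rk <= r by rewrite ler_piMr ?(ltW r0)// exprn_ile1// ltW.
have TkT : Tk <= T by rewrite ler_piMr ?(ltW T0)// exprn_ile1// ltW.
have sub : ccyl x t rk Tk `<=` ccyl x t r T by apply: ccylW => //; exact: ltW.
have [||a||||m'' H] := oscillation_step_scaled q delta kap lam e0 e u x t
  rk Tk m' wk step lam01 rk0 Tk0 wk0.
- have -> : wk / rk = w / r * ((1 - kap) / l) ^+ k.
    rewrite /wk /rk expr_div_n; field.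
    by rewrite expf_neq0 ?gt_eqF.
  rewrite powRM ?divr_ge0 ?exprn_ge0 ?divr_ge0 ?(ltW w0) ?(ltW r0) ?(ltW mu0) ?(ltW l0)//.
  rewrite sc -powR_mulrn ?divr_ge0 ?(ltW mu0) ?(ltW l0)// powRAC mueq.
  rewrite powR_mulrn ?divr_ge0 ?(ltW mu0) ?(ltW b0)//.
  rewrite /wk /Tk expr_div_n; field.
  by rewrite expf_neq0 ?gt_eqF.
- apply: le_trans ee.
  have -> : e * Tk / wk = e * T / w * (b / (1 - kap)) ^+ k.
    rewrite /wk /Tk expr_div_n; field.
    by rewrite expf_neq0 ?gt_eqF.
  rewrite ler_piMr//.
    by rewrite divr_ge0 ?mulr_ge0 ?(ltW w0) ?(ltW T0).
  rewrite exprn_ile1 ?divr_ge0 ?(ltW b0) ?(ltW mu0)//.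
  by rewrite ler_pdivrMr// mul1r.
- by move=> /sub; exact: uc.
- exact: sub_onW sub _ us.
- exact: super_onW sub _ up.
- exact: IH.
exists m'' => a Ha.
have -> : w * (1 - kap) ^+ k.+1 = (1 - kap) * wk by rewrite /wk exprS; ring.
apply: H; move: a Ha; apply: ccylW.
- by rewrite mulr_ge0 ?exprn_ge0 ?(ltW r0) ?(ltW l0).
- by rewrite exprS mulrCA ler_wpM2r// ltW.
- by rewrite exprS mulrCA ler_wpM2r// ltW.
Qed.

(** Stop at the first scale [k] at which one of the two distances exceeds the size
    of the cylinder. The bound at the previous scale gives [D <= (w / mu) mu^k],
    and the exponents are those for which [mu^k] is at most the corresponding
    power of that distance. *)
Lemma holder_of_geometric_decay (d1 d2 D r T w l b mu al ga : R) :
  0 <= d1 -> 0 <= d2 -> 0 < r -> 0 < T -> 0 < w -> 0 < l -> 0 < b -> 0 < mu < 1 ->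
  0 < al -> 0 < ga -> l `^ al = mu -> b `^ ga = mu -> D <= w ->
  (forall k, d1 <= r * l ^+ k -> d2 <= T * b ^+ k -> D <= w * mu ^+ k) ->
  D <= w / mu * ((d1 / r) `^ al + (d2 / T) `^ ga).
Proof.
move=> d10 d20 r0 T0 w0 l0 b0 /andP[mu0 mu1] al0 ga0 lE bE Dw H.
have rhs0 : 0 <= w / mu * ((d1 / r) `^ al + (d2 / T) `^ ga).
  by rewrite mulr_ge0 ?divr_ge0 ?addr_ge0 ?powR_ge0// ltW.
have far (d s h a : R) k : 0 < s -> 0 < h -> 0 < a -> h `^ a = mu -> s * h ^+ k < d ->
    mu ^+ k <= (d / s) `^ a.
  move=> s0 h0 a0 hE dk.
  rewrite -hE -powR_mulrn ?powR_ge0// powRAC powR_mulrn ?(ltW h0)//.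
  apply: ge0_ler_powR; rewrite ?nnegrE ?(ltW a0) ?exprn_ge0 ?(ltW h0)//.
    rewrite divr_ge0 ?(ltW s0)// ltW// (le_lt_trans _ dk)//.
    by rewrite mulr_ge0 ?exprn_ge0 ?(ltW s0) ?(ltW h0).
  by rewrite ler_pdivlMr// mulrC ltW.
pose P k := ~~ ((d1 <= r * l ^+ k) && (d2 <= T * b ^+ k)).
have [exP|nexP] := pselect (exists k, P k).
  case: (ex_minnP exP) => k Pk kmin.
  have Dk : D <= w / mu * mu ^+ k.
    case: k Pk kmin => [|k] Pk kmin.
      by rewrite expr0 mulr1 (le_trans Dw)// ler_peMr ?(ltW w0)// invf_ge1// ltW.
    rewrite exprS mulrA divfK ?gt_eqF//.
    have : ~~ P k by apply/negP => /kmin; rewrite ltnn.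
    by rewrite /P negbK => /andP[]; exact: H.
  apply: (le_trans Dk); rewrite ler_wpM2l ?divr_ge0 ?(ltW w0) ?(ltW mu0)//.
  move: Pk; rewrite /P negb_and -!ltNge => /orP[] dk.
    by rewrite (le_trans (far _ _ _ _ _ r0 l0 al0 lE dk))// lerDl powR_ge0.
  by rewrite (le_trans (far _ _ _ _ _ T0 b0 ga0 bE dk))// lerDr powR_ge0.
apply: le_trans rhs0; rewrite leNgt; apply/negP => D0.
have : (w * mu ^+ k) @[k --> \oo] --> w * 0.
  apply: cvgMr; apply: cvg_expr; rewrite ger0_norm// ltW//.
rewrite mulr0 => /(cvgr_lt 0) /(_ _ D0) [k _ /(_ k (leqnn k)) /=].
apply/negP; rewrite -leNgt.
have : ~~ P k by apply/negP => Pk; apply: nexP; exists k.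
by rewrite /P negbK => /andP[]; exact: H.
Qed.
Lemma holder_at_point q delta kap lam e0 e u x t r T m w l b al ga y s :
  @oscillation_drops R N q delta kap lam e0 -> 0 < r -> 0 < T -> 0 < w -> 0 <= e ->
  0 < kap < 1 -> 0 < l <= lam -> 0 < b <= lam -> lam <= 1 ->
  ((1 - kap) / l) `^ q = (1 - kap) / b -> b <= 1 - kap ->
  (w / r) `^ q = w / T -> e * T / w <= e0 ->
  (forall a, ccyl x t r T a -> {for a, continuous u}) ->
  sub_on (ccyl x t r T) delta^-1 q e u ->
  super_on (ccyl x t r T) delta q e u ->
  (forall a, ccyl x t r T a -> m <= u a <= m + w) ->
  0 < al -> 0 < ga -> l `^ al = 1 - kap -> b `^ ga = 1 - kap ->
  `|u (x, t) - u (y, s)| <= w ->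
  `|u (x, t) - u (y, s)| <=
    w / (1 - kap) * ((enorm (x - y) / r) `^ al + (`|t - s| / T) `^ ga).
Proof.
move=> step r0 T0 w0 e_ge0 k01 l0 b0 lam1 mueq bmu sc ee uc us up ub al0 ga0 lE bE Dw.
have dec := oscillation_decay q delta kap lam e0 e u x t r T m w l b
  step r0 T0 w0 e_ge0 k01 l0 b0 lam1 mueq bmu sc ee uc us up ub.
have [{}l0 _] := andP l0; have [{}b0 _] := andP b0.
apply: (holder_of_geometric_decay _ _ _ r T w l b) => //.
- exact: enorm_ge0.
- by clear -k01; case/andP: k01 => ? ?; apply/andP; split; lra.
move=> k dx dts; have [c osc] := dec k.
have Tk0 : 0 <= T * b ^+ k by rewrite mulr_ge0 ?exprn_ge0 ?(ltW T0) ?(ltW b0).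
have rk0 : 0 <= r * l ^+ k by rewrite mulr_ge0 ?exprn_ge0 ?(ltW r0) ?(ltW l0).
apply: (distr_le_itv c).
  apply: osc; split => /=.
    by rewrite subrr /nsq big1 ?sqr_ge0// => i _; rewrite mxE expr0n.
  by rewrite lerBlDr lerDl Tk0.
apply: osc; split => /=.
  by rewrite -opprB nsqN -enorm_le.
by move: dts; rewrite ler_distlC => /andP[-> ->].
Qed.

End decay.

(** * From the equation to the two growth inequalities *)

Section viscosity.
Context {R : realType} {N : nat}.
Context (O : set ('rV[R]_N * R)) (H : ('rV[R]_N * R) * 'rV[R]_N -> R).

Lemma C1_onW phi : C1_on setT phi -> C1_on O phi.
Proof.
move=> [d dc gc]; split; first by move=> a _; exact: d.
- exact: continuous_subspaceW dc.
- exact: continuous_subspaceW gc.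
Qed.

Lemma viscosity_sub_on (c q e : R) u :
  (forall a z, O a -> c * enorm z `^ q - e <= H (a, z)) ->
  viscosity_subsolution O H u -> sub_on O c q e u.
Proof.
move=> Hle us phi a /C1_onW C1 Oa lm.
have := us _ _ C1 Oa lm; have := Hle a (grad_x phi a) Oa; lra.
Qed.

Lemma viscosity_super_on (c q e : R) u :
  (forall a z, O a -> H (a, z) <= c * enorm z `^ q + e) ->
  viscosity_supersolution O H u -> super_on O c q e u.
Proof.
move=> Hle us phi a /C1_onW C1 Oa lm.
have := us _ _ C1 Oa lm; have := Hle a (grad_x phi a) Oa; lra.
Qed.

(** Radius and duration at most [rho / 2] put the cylinder inside the Euclidean
    ball of radius [rho / sqrt 2]. *)
Lemma ccyl_sub_inner (rho r T : R) x t : 0 < rho -> 0 <= r -> 0 <= T ->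
  r <= rho / 2 -> T <= rho / 2 -> inner_set O rho (x, t) -> ccyl x t r T `<=` O.
Proof.
move=> rho0 r0 T0 rr TT [_ dist] a [ar /andP[as_ aT]]; apply: contrapT => nOa.
have : (set_edist (~` O) (x, t) <= (st_edist (x, t) a)%:E)%E.
  by apply: ereal_inf_lbound; exists a.
apply/negP; rewrite -ltNge; apply: le_lt_trans dist; rewrite lee_fin.
rewrite /st_edist enorm_sqr -[rho](ger0_norm (ltW rho0)) -sqrtr_sqr ler_wsqrtr//=.
rewrite -opprB nsqN.
have : r ^+ 2 <= (rho / 2) ^+ 2 by rewrite lerXn2r ?nnegrE//; lra.
have : (t - a.2) ^+ 2 <= (rho / 2) ^+ 2 by nra.
have := sqr_ge0 rho; lra.
Qed.
End viscosity.

(** * Exponents *)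

Section exponents.
Context {R : realType}.

Lemma conjugate_exponent (p q : R) : 1 < q -> 1 / p + 1 / q = 1 -> p = q / (q - 1).
Proof.
move=> q1 hp.
have p0 : p != 0.
  apply/eqP => p0; move: hp; rewrite p0 invr0 mulr0 add0r => h.
  have := divfK (_ : q != 0) 1; rewrite h gt_eqF//; lra.
have : p * q * (1 / p + 1 / q) = p * q by rewrite hp mulr1.
have -> : p * q * (1 / p + 1 / q) = q + p by field; rewrite p0 gt_eqF//; lra.
move=> E; apply: (@mulIf _ (q - 1)); first by rewrite gt_eqF//; lra.
by rewrite divfK; [lra|rewrite gt_eqF//; lra].
Qed.

(** The spatial ratio [l] is chosen first, small enough for the time ratio [b] it
    determines to be at most [lam]. Writing [mu = l ^ al] gives [b = l ^ be] with
    [be = q - (q - 1) * al], which is why the exponent in time is [al / be]. *)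
Lemma holder_parameters (q lam mu : R) : 1 < q -> 0 < lam -> 0 < mu < 1 -> lam < 1 ->
  exists l b al be : R,
    [/\ 0 < l <= lam, 0 < b <= lam, b <= mu & (mu / l) `^ q = mu / b] /\
    [/\ 0 < al < 1, be = q - (q - 1) * al, 0 < be, l `^ al = mu & b `^ (al / be) = mu].
Proof.
move=> hq lam0 /andP[mu0 mu1] lam1.
have q0 : 0 < q by lra.
have q10 : 0 < q - 1 by lra.
pose l := lam * mu.
have l0 : 0 < l by rewrite mulr_gt0.
have llam : l <= lam by rewrite ler_piMr// ltW.
have lmu : l < mu by rewrite /l -ltr_pdivlMr// divff ?gt_eqF//; lra.
have lV : 0 < l / mu <= 1 by rewrite divr_gt0//= ler_pdivrMr// mul1r ltW.
pose b := mu * (l / mu) `^ q.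
have b0 : 0 < b by rewrite mulr_gt0// powR_gt0// divr_gt0.
have bmu : b <= mu.
  rewrite ler_piMr ?(ltW mu0)//.
  by case/andP: lV => ? ?; apply: le_trans (ge1r_powR _ (ltW hq)) _ => //; apply/andP.
have blam : b <= lam.
  have h : (l / mu) `^ q <= l / mu by apply: ge1r_powR => //; exact: ltW.
  have : mu * (l / mu) `^ q <= mu * (l / mu) by rewrite ler_wpM2l// ltW.
  have -> : mu * (l / mu) = l by field; rewrite gt_eqF.
  by rewrite -/b => /le_trans; apply.
have mub : (mu / l) `^ q = mu / b.
  have -> : mu / l = (l / mu)^-1 by rewrite invf_div.
  rewrite /b -powR_inv1; last by case/andP: lV => /ltW.
  rewrite -powRrM mulN1r powRN; field.
  by rewrite gt_eqF ?powR_gt0 ?divr_gt0//= gt_eqF.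
have lnl : ln l < 0 by rewrite ln_lt0// l0; lra.
have lnmu : ln mu < 0 by rewrite ln_lt0// mu0.
pose al := ln mu / ln l.
have al0 : 0 < al by rewrite /al -divrNN divr_gt0// oppr_gt0.
have al1 : al < 1.
  by rewrite /al ltr_ndivrMr// mul1r ltr_ln ?posrE.
have lE : l `^ al = mu.
  by rewrite /powR gt_eqF// /al divfK ?lt_eqF// lnK.
pose be := q - (q - 1) * al.
have be0 : 0 < be by rewrite /be; nra.
have bE : b `^ (al / be) = mu.
  have lnz : l != 0 by rewrite gt_eqF.
  have -> : b = l `^ be.
    rewrite /b -{1 2}lE -[l in l / _](powRr1 (ltW l0)) -powRB ?lnz ?implybT//.
    rewrite -powRrM -powRD ?lnz ?implybT//.
    by congr (_ `^ _); rewrite /be; ring.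
  by rewrite -powRrM mulrCA mulfV ?mulr1// gt_eqF.
exists l, b, al, be; split; split => //.
- by rewrite l0.
- by rewrite b0.
- by rewrite al0.
Qed.
End exponents.

Theorem theorem4p8 (R : realType) (N : nat) (q delta eta_m eta_p M p : R)
    (hN : (1 <= N)%N) (hq : 1 < q) (hdelta : 1 <= delta)
    (heta_m : 0 <= eta_m) (heta_p : 0 <= eta_p) (hM : 0 <= M)
    (hp : 1 / p + 1 / q = 1) :
  exists theta : R, p < theta /\
  exists C : R -> R, (forall rho : R, 0 < rho -> 0 <= C rho) /\
  forall (O : set ('rV[R]_N * R)) (H : ('rV[R]_N * R) * 'rV[R]_N -> R)
      (u : 'rV[R]_N * R -> R),
    open O ->
    {within O `*` setT, continuous H} ->
    (forall (a : 'rV[R]_N * R) (z : 'rV[R]_N), O a ->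
       1 / delta * enorm z `^ q - eta_m <= H (a, z) /\
       H (a, z) <= delta * enorm z `^ q + eta_p) ->
    continuous_viscosity_solution O H u ->
    (forall a : 'rV[R]_N * R, O a -> `|u a| <= M) ->
    forall rho : R, 0 < rho ->
    forall (x y : 'rV[R]_N) (t s : R),
      inner_set O rho (x, t) -> inner_set O rho (y, s) ->
      `|u (x, t) - u (y, s)| <=
        C rho * (enorm (x - y) `^ ((theta - p) / (theta - 1)) +
                 `|t - s| `^ ((theta - p) / theta)).
Proof.
have q10 : 0 < q - 1 by clear -hq; lra.
have delta0 : 0 < delta by clear -hdelta; lra.
have pE := conjugate_exponent p q hq hp.
have [kap [lam [e0 [/andP[k0 k1] /andP[lam0 lam1] e00 step]]]] :=
  @oscillation_step R N q delta hq delta0.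
have lam_lt1 : lam < 1 by clear -lam1; lra.
have k01 : 0 < kap < 1 by clear -k0 k1; apply/andP; split; lra.
pose mu := 1 - kap.
have mu01 : 0 < mu < 1 by clear -k0 k1; rewrite /mu; apply/andP; split; lra.
have [mu0 _] := andP mu01.
have [l [b [al [be [[l01 b01 bmu mub] [/andP[al0 al1] beE be0 lE bE]]]]]] :=
  holder_parameters q lam mu hq lam0 mu01 lam_lt1.
pose theta := (p - al) / (1 - al).
have qn : q - 1 != 0 by rewrite gt_eqF.
have an : 1 - al != 0 by rewrite gt_eqF// subr_gt0.
have ben : be != 0 by rewrite gt_eqF.
have thE : theta = be / ((q - 1) * (1 - al)).
  by rewrite /theta pE beE; field; rewrite ?qn ?an.
have thp : theta - p = al / ((q - 1) * (1 - al)).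
  by rewrite /theta pE; field; rewrite ?qn ?an.
have thx : (theta - p) / (theta - 1) = al.
  have -> : theta - 1 = 1 / ((q - 1) * (1 - al)).
    by rewrite /theta pE; field; rewrite ?qn ?an.
  by rewrite thp; field; rewrite ?qn ?an ?oner_neq0.
have tht : (theta - p) / theta = al / be.
  by rewrite thp thE; field; rewrite ?qn ?an ?ben.
exists theta; split.
  by rewrite -subr_gt0 thp divr_gt0// mulr_gt0// subr_gt0.
pose w := 2 * M + 1.
have w0 : 0 < w by clear -hM; rewrite /w; lra.
pose e := eta_m + eta_p.
have e_ge0 : 0 <= e by rewrite addr_ge0.
have e1 : 0 < e + 1 by rewrite ltr_wpDl.
(* [z] is the ratio of the initial radius to the initial height: the cylinder
   must fit in a ball of radius [rho] and the rescaled errors be below [e0]. *)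
pose z (rho : R) := Num.min 1 (Num.min (rho / (2 * w)) (e0 / (e + 1))).
have z0 rho : 0 < rho -> 0 < z rho.
  by move=> rho0; rewrite !lt_min ltr01 !divr_gt0// mulr_gt0.
pose r rho := w * z rho.
pose T rho := w * z rho `^ q.
have r0 rho : 0 < rho -> 0 < r rho by move=> /z0 ?; rewrite mulr_gt0.
have T0 rho : 0 < rho -> 0 < T rho by move=> /z0 ?; rewrite mulr_gt0// powR_gt0.
exists (fun rho => w / mu * ((r rho)^-1 `^ al + (T rho)^-1 `^ (al / be))); split.
  by move=> rho rho0; rewrite mulr_ge0 ?addr_ge0 ?powR_ge0// divr_ge0// ltW.
move=> O H u oO _ Hb [uc us up] uM rho rho0 x y t s Ox Oy.
have zle1 : z rho <= 1 by rewrite ge_min lexx.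
have zrho : z rho <= rho / (2 * w) by rewrite !ge_min lexx orbT.
have ze : z rho <= e0 / (e + 1) by rewrite !ge_min lexx !orbT.
have zq : z rho `^ q <= z rho by apply: ge1r_powR; [rewrite z0|exact: ltW].
have rrho : r rho <= rho / 2.
  have -> : rho / 2 = w * (rho / (2 * w)) by field; rewrite gt_eqF.
  by rewrite ler_wpM2l// ltW.
have Trho : T rho <= rho / 2 by apply: le_trans rrho; rewrite ler_wpM2l// ltW.
have sub : ccyl x t (r rho) (T rho) `<=` O.
  by apply: (ccyl_sub_inner O rho) => //; rewrite ltW// (r0,T0).
have uca a : ccyl x t (r rho) (T rho) a -> {for a, continuous u}.
  move=> /sub Oa; move: uc; rewrite continuous_open_subspace// => /(_ a).
  by apply; rewrite inE.
have subs : sub_on (ccyl x t (r rho) (T rho)) delta^-1 q e u.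
  apply: (sub_onW _ _ _ _ _ _ _ sub (lexx _)).
  apply: viscosity_sub_on us => a zz Oa.
  have [h _] := Hb a zz Oa; apply: le_trans h.
  by rewrite div1r lerD2l lerN2 lerDl.
have sups : super_on (ccyl x t (r rho) (T rho)) delta q e u.
  apply: (super_onW _ _ _ _ _ _ _ sub (lexx _)).
  apply: viscosity_super_on up => a zz Oa.
  have [_ h] := Hb a zz Oa; apply: (le_trans h).
  by rewrite lerD2l lerDr.
have sc : (w / r rho) `^ q = w / T rho.
  have zn := z0 _ rho0.
  have -> : w / r rho = (z rho)^-1 by rewrite /r; field; rewrite !gt_eqF.
  rewrite -(powR_inv1 (ltW zn)) -powRrM mulN1r powRN /T; field.
  by rewrite !gt_eqF ?powR_gt0.
have ee : e * T rho / w <= e0.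
  have -> : e * T rho / w = e * z rho `^ q by rewrite /T; field; rewrite gt_eqF.
  apply: (le_trans (ler_wpM2l e_ge0 zq)).
  apply: (@le_trans _ _ ((e + 1) * z rho)).
    by rewrite ler_wpM2r ?lerDl// ltW// z0.
  by rewrite mulrC -ler_pdivlMr.
have uMw a : O a -> - M <= u a <= - M + w.
  move=> /uM; rewrite ler_norml /w => /andP[u1 u2].
  by clear -u1 u2; apply/andP; split; lra.
have [Ox1 _] := Ox; have [Oy1 _] := Oy.
have Dw : `|u (x, t) - u (y, s)| <= w by apply: (distr_le_itv (- M)); exact: uMw.
have := holder_at_point q delta kap lam e0 e u x t (r rho) (T rho) (- M) w l b
  al (al / be) y s step (r0 _ rho0) (T0 _ rho0) w0 e_ge0 k01 l01 b01 (ltW lam_lt1)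
  mub bmu sc ee uca subs sups (fun a Qa => uMw a (sub a Qa))
  al0 (divr_gt0 al0 be0) lE bE Dw.
move/le_trans; apply; rewrite thx tht -[X in _ <= X]mulrA ler_pM2l ?divr_gt0//.
have dr : (enorm (x - y) / r rho) `^ al = (r rho)^-1 `^ al * enorm (x - y) `^ al.
  by rewrite mulrC powRM ?enorm_ge0// invr_ge0 ltW// r0.
have dT : (`|t - s| / T rho) `^ (al / be) =
    (T rho)^-1 `^ (al / be) * `|t - s| `^ (al / be).
  by rewrite mulrC powRM// invr_ge0 ltW// T0.
rewrite dr dT mulrDl !mulrDr.
have c1 := mulr_ge0 (powR_ge0 (r rho)^-1 al) (powR_ge0 `|t - s| (al / be)).
have c2 := mulr_ge0 (powR_ge0 (T rho)^-1 (al / be)) (powR_ge0 (enorm (x - y)) al).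
by rewrite -addrA lerD2l addrCA addrA lerDr addr_ge0.
Qed.
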